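(* Let $(R,\mathfrak m,k)$ be a Gorenstein local ring with $\mathfrak m^3=0$, and set $\Omega^R_{-n}(k)=\operatorname{Hom}_R(\Omega^R_n(k),R)$ for each $n\ge1$. Set $e=\operatorname{rank}_k(\mathfrak m/\mathfrak m^2)$, assume $e\ge2$, and let $(b_n)_{n\ge0}$ be the sequence with $b_0=1$, $b_1=e$, and $b_{n+1}=e\,b_n-b_{n-1}$ for $n\ge1$. A finite $R$-module $M$ is Koszul if and only if it has no direct summand isomorphic to $\Omega^R_{-i}(k)$ with $i\ge1$. Furthermore, when $M$ is an indecomposable finite $R$-module the following are equivalent. (i) $M$ is not Koszul. (ii) $M\cong\Omega^R_{-i}(k)$ for some $i\ge1$. (iii) $H_M(t)=b_{i-1}+b_i\,t$ for some $i\ge1$.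
   Context: A local ring $(R,\mathfrak m,k)$ is a commutative Noetherian ring $R$ with unique maximal ideal $\mathfrak m$ and residue field $k=R/\mathfrak m$. ''Finite'' means finitely generated; $\operatorname{rank}_k$ is dimension over $k$. Syzygies: for $n\ge0$, $\Omega^R_n(M)=\operatorname{Coker}(\partial^F_{n+1})$ where $F$ is a minimal free resolution of $M$. Hilbert series: $H_M(t)=\sum_{n\ge0}\operatorname{rank}_k(\mathfrak m^nM/\mathfrak m^{n+1}M)\,t^n$. Koszul: let $F$ be a minimal free resolution of a finite $R$-module $M$. For each $j\ge0$ the differential and the augmentation induce a complex of $k$-vector spaces $$\operatorname{lin}_j(F)=\quad 0\to \frac{F_j}{\mathfrak mF_j}\to\cdots\to\frac{\mathfrak m^{j-n}F_n}{\mathfrak m^{j+1-n}F_n}\to\cdots\to\frac{\mathfrak m^{j}F_0}{\mathfrak m^{j+1}F_0}\to\frac{\mathfrak m^jM}{\mathfrak m^{j+1}M}\to0;$$ $M$ is Koszul if $\operatorname{lin}_j(F)$ is acyclic for every $j\ge0$. *)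

(* Defs.v *)
From HB Require Import structures.
From mathcomp Require Import all_boot all_order all_algebra.
From mathcomp Require Import boolp classical_sets functions.

Set Implicit Arguments.
Unset Strict Implicit.
Unset Printing Implicit Defensive.

Import GRing.Theory.
Local Open Scope classical_set_scope.
Local Open Scope ring_scope.
Local Open Scope quotient_scope.

Definition is_submodule (R : pzRingType) (V : lmodType R) (N : set V) : Prop :=
  N 0 /\ forall (a : R) (x y : V), N x -> N y -> N (a *: x + y).

Record submodule (R : pzRingType) (V : lmodType R) := Submodule {
  submodule_set :> set V;
  submoduleP : is_submodule submodule_set
}.

Notation ideal R := (submodule R^o).

(* Hom_R(U, V), as an R-module. *)
Section Hom.
Variables (R : comNzRingType) (U V : lmodType R).

Definition hom : Type := {linear U -> V}.

HB.instance Definition _ := gen_eqMixin hom.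
HB.instance Definition _ := gen_choiceMixin hom.

Lemma hom_ext (f g : hom) :
  (forall x, (f : {linear U -> V}) x = (g : {linear U -> V}) x) -> f = g.
Proof.
case: f => f [[pf] [qf]]; case: g => g [[pg] [qg]] /= fg.
have {}fg : f = g by exact/funext.
by subst g; rewrite (Prop_irrelevance pf pg) (Prop_irrelevance qf qg).
Qed.

Definition hom_zero : hom := (\0 : U -> V).
Definition hom_opp (f : hom) : hom := (\- (f : {linear U -> V})).
Definition hom_add (f g : hom) : hom :=
  ((f : {linear U -> V}) \+ (g : {linear U -> V})).
Definition hom_scale (a : R) (f : hom) : hom := (a \*: (f : {linear U -> V})).

Fact hom_addA : associative hom_add.
Proof. by move=> f g h; apply: hom_ext => x /=; rewrite addrA. Qed.
Fact hom_addC : commutative hom_add.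
Proof. by move=> f g; apply: hom_ext => x /=; rewrite addrC. Qed.
Fact hom_add0 : left_id hom_zero hom_add.
Proof. by move=> f; apply: hom_ext => x /=; rewrite add0r. Qed.
Fact hom_addN : left_inverse hom_zero hom_opp hom_add.
Proof. by move=> f; apply: hom_ext => x /=; rewrite addNr. Qed.

HB.instance Definition _ :=
  GRing.isZmodule.Build hom hom_addA hom_addC hom_add0 hom_addN.

Fact hom_scaleA a b f : hom_scale a (hom_scale b f) = hom_scale (a * b) f.
Proof. by apply: hom_ext => x /=; rewrite scalerA. Qed.
Fact hom_scale1 : left_id 1 hom_scale.
Proof. by move=> f; apply: hom_ext => x /=; rewrite scale1r. Qed.
Fact hom_scaleDr : right_distributive hom_scale +%R.
Proof. by move=> a f g; apply: hom_ext => x /=; rewrite scalerDr. Qed.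
Fact hom_scaleDl f : {morph hom_scale^~ f : a b / a + b}.
Proof. by move=> a b; apply: hom_ext => x /=; rewrite scalerDl. Qed.

HB.instance Definition _ := GRing.Zmodule_isLmodule.Build R hom
  hom_scaleA hom_scale1 hom_scaleDr hom_scaleDl.

End Hom.

(* The quotient module V / N. *)
Section Quotient.
Variables (R : pzRingType) (V : lmodType R) (N : submodule V).

Fact sub_mem0 : submodule_set N 0. Proof. by case: N => ? []. Qed.
Fact sub_memD x y : submodule_set N x -> submodule_set N y -> submodule_set N (x + y).
Proof. by case: N => ? [_ H] /=; rewrite -{2}(scale1r x); exact: H. Qed.
Fact sub_memZ a x : submodule_set N x -> submodule_set N (a *: x).
Proof.
case: N => ? [H0 H] /= Nx; rewrite -(addr0 (a *: x)); exact: H.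
Qed.
Fact sub_memN x : submodule_set N x -> submodule_set N (- x).
Proof. by rewrite -scaleN1r; exact: sub_memZ. Qed.

Definition mod_equiv (x y : V) : bool := `[< submodule_set N (x - y) >].

Fact mod_equiv_class : equiv_class_of mod_equiv.
Proof.
split=> [x|x y|y x z].
- by apply/asboolP; rewrite subrr; exact: sub_mem0.
- by apply/asboolP/asboolP => /sub_memN; rewrite opprB.
- move=> /asboolP xy /asboolP yz; apply/asboolP.
  by rewrite -[x](subrK y) -addrA; exact: sub_memD.
Qed.

Canonical mod_equiv_rel := EquivRelPack mod_equiv_class.
Canonical mod_equiv_encModRel := defaultEncModRel mod_equiv.

Definition quotient : Type := {eq_quot mod_equiv}.

HB.instance Definition _ : EqQuotient V mod_equiv quotient :=
  EqQuotient.on quotient.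
HB.instance Definition _ := Choice.on quotient.

Definition quo_zero : quotient := lift_cst quotient 0.
Definition quo_add := lift_op2 quotient +%R.
Definition quo_opp := lift_op1 quotient -%R.
Definition quo_scale (a : R) := lift_op1 quotient ( *:%R a).

Fact quo_eqP (x y : V) : \pi_quotient x = \pi_quotient y <-> submodule_set N (x - y).
Proof.
by split=> [/eqP|xy]; last apply/eqP; rewrite piE /= => *; exact/asboolP.
Qed.

Canonical pi_quo_zero := PiConst quo_zero.

Fact pi_quo_opp : {morph \pi : x / - x >-> quo_opp x}.
Proof.
move=> x; unlock quo_opp; apply/quo_eqP; rewrite -opprD; apply: sub_memN.
by apply/quo_eqP; rewrite reprK.
Qed.
Canonical pi_quo_opp_morph := PiMorph1 pi_quo_opp.

Fact pi_quo_add : {morph \pi : x y / x + y >-> quo_add x y}.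
Proof.
move=> x y; unlock quo_add; apply/quo_eqP; rewrite opprD addrACA.
by apply: sub_memD; apply/quo_eqP; rewrite reprK.
Qed.
Canonical pi_quo_add_morph := PiMorph2 pi_quo_add.

Fact pi_quo_scale a : {morph \pi : x / a *: x >-> quo_scale a x}.
Proof.
move=> x; unlock quo_scale; apply/quo_eqP; rewrite -scalerBr.
by apply: sub_memZ; apply/quo_eqP; rewrite reprK.
Qed.
Canonical pi_quo_scale_morph a := PiMorph1 (pi_quo_scale a).

Fact quo_addA : associative quo_add.
Proof. by move=> x y z; rewrite -[x]reprK -[y]reprK -[z]reprK !piE addrA. Qed.
Fact quo_addC : commutative quo_add.
Proof. by move=> x y; rewrite -[x]reprK -[y]reprK !piE addrC. Qed.
Fact quo_add0 : left_id quo_zero quo_add.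
Proof. by move=> x; rewrite -[x]reprK !piE add0r. Qed.
Fact quo_addN : left_inverse quo_zero quo_opp quo_add.
Proof. by move=> x; rewrite -[x]reprK !piE addNr. Qed.

HB.instance Definition _ :=
  GRing.isZmodule.Build quotient quo_addA quo_addC quo_add0 quo_addN.

Fact quo_scaleA a b x : quo_scale a (quo_scale b x) = quo_scale (a * b) x.
Proof. by rewrite -[x]reprK !piE scalerA. Qed.
Fact quo_scale1 : left_id 1 quo_scale.
Proof. by move=> x; rewrite -[x]reprK !piE scale1r. Qed.
Fact quo_scaleDr : right_distributive quo_scale +%R.
Proof.
by move=> a x y; rewrite -[x]reprK -[y]reprK /GRing.add /= !piE scalerDr.
Qed.
Fact quo_scaleDl x : {morph quo_scale^~ x : a b / a + b}.
Proof. by move=> a b; rewrite -[x]reprK /GRing.add /= !piE scalerDl. Qed.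

HB.instance Definition _ := GRing.Zmodule_isLmodule.Build R quotient
  quo_scaleA quo_scale1 quo_scaleDr quo_scaleDl.

End Quotient.

Fact range_is_submodule (R : pzRingType) (U V : lmodType R)
  (f : {linear U -> V}) : is_submodule (range f).
Proof.
split=> [|a _ _ [x _ <-] [y _ <-]]; first by exists 0; rewrite ?linear0.
by exists (a *: x + y); rewrite ?linearP.
Qed.

Definition coker (R : pzRingType) (U V : lmodType R) (f : {linear U -> V}) :
  lmodType R := quotient (Submodule (range_is_submodule f)).

Section Modules.
Variable R : comNzRingType.
Implicit Types M N : lmodType R.

Definition isomorphic M N : Prop := exists f : {linear M -> N}, bijective f.

Definition zero_module M : Prop := forall x : M, x = 0.

Definition direct_summand N M : Prop :=
  exists N' : lmodType R, isomorphic M (N * N')%type.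

Definition indecomposable M : Prop :=
  ~ zero_module M /\
  forall N N' : lmodType R, isomorphic M (N * N')%type ->
    zero_module N \/ zero_module N'.

Definition fin_gen M (N : set M) : Prop :=
  exists (n : nat) (x : 'I_n -> M),
    N = range (fun a : 'I_n -> R => \sum_i a i *: x i).

Definition finite_module M : Prop := fin_gen [set: M].

Definition noetherian : Prop := forall I : ideal R, fin_gen I.

Definition maximal_ideal (I : ideal R) : Prop :=
  ~ submodule_set I 1 /\
  forall J : ideal R, I `<=` J -> ~ submodule_set J 1 -> J = I :> set R^o.

Definition local_ring (m : ideal R) : Prop :=
  [/\ noetherian, maximal_ideal m &
      forall n : ideal R, maximal_ideal n -> n = m :> set R^o].

Definition injective_module (E : lmodType R) : Prop :=
  forall (A B : lmodType R) (f : {linear A -> B}) (g : {linear A -> E}),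
    injective f -> exists h : {linear B -> E}, forall x, h (f x) = g x.

Definition exact_at (A B C : lmodType R) (f : A -> B) (g : B -> C) : Prop :=
  forall y, g y = 0 <-> range f y.

Definition finite_injective_dimension M : Prop :=
  exists (n : nat) (E : nat -> lmodType R) (eta : {linear M -> E 0%N})
         (d : forall j, {linear E j -> E j.+1}),
    [/\ forall j, injective_module (E j),
        forall j, (n < j)%N -> zero_module (E j),
        injective eta,
        exact_at eta (d 0%N) &
        forall j, exact_at (d j) (d j.+1)].

Definition gorenstein_local_ring (m : ideal R) : Prop :=
  local_ring m /\ finite_injective_dimension R^o.

Section OverLocalRing.
Variable m : ideal R.

Definition ideal_mul (I : set R^o) M (N : set M) : set M :=
  [set y | exists (n : nat) (a : 'I_n -> R) (x : 'I_n -> M),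
     [/\ forall i, I (a i), forall i, N (x i) & y = \sum_i a i *: x i]].

(* mpow n M is m^n M; in particular mpow n R^o is the ideal m^n. *)
Definition mpow (n : nat) M : set M := iter n (@ideal_mul m M) [set: M].
Arguments mpow n M : clear implicits.

Definition residue_field : lmodType R := quotient m.

(* For m A `<=` B `<=` A the classes of the x i form a basis of A / B over
   the field R / m. *)
Definition residue_basis M (A B : set M) (d : nat) (x : 'I_d -> M) : Prop :=
  [/\ forall i, A (x i),
      forall y, A y -> exists a : 'I_d -> R, B (y - \sum_i a i *: x i) &
      forall a : 'I_d -> R, B (\sum_i a i *: x i) -> forall i, submodule_set m (a i)].

(* The rank over R / m of A / B; junk value 0 if there is no finite basis. *)
Definition krank M (A B : set M) : nat :=
  xget 0%N [set d | exists x : 'I_d -> M, residue_basis A B x].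

(* The n-th coefficient of the Hilbert series of M. *)
Definition hilbert M (n : nat) : nat := krank (mpow n M) (mpow n.+1 M).

Record minimal_free_resolution M := MinimalFreeResolution {
  betti : nat -> nat;
  diff : forall n, {linear 'rV[R]_(betti n.+1) -> 'rV[R]_(betti n)};
  aug : {linear 'rV[R]_(betti 0) -> M};
  aug_surj : range aug = [set: M];
  exact_aug : exact_at (diff 0) aug;
  exact_diff : forall n, exact_at (diff n.+1) (diff n);
  diff_minimal : forall n x, mpow 1 'rV[R]_(betti n) (diff n x)
}.

Definition syzygy M (F : minimal_free_resolution M) (n : nat) : lmodType R :=
  coker (diff F n).

(* M is isomorphic to Omega_{-n}(k) = Hom_R(Omega_n(k), R). Minimal free resolutions exist and
   are unique up to isomorphism, so the choice of F is immaterial here and in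
   koszul. *)
Definition iso_neg_syzygy (n : nat) M : Prop :=
  exists F : minimal_free_resolution residue_field,
    isomorphic M (hom (syzygy F n) R^o).

(* Exactness at B1 / B0 of the complex A1 / A0 -> B1 / B0 -> C1 / C0 induced by
   f and g; A0 and C1 play no role. *)
Definition exact_subquotient (A B C : lmodType R)
    (A1 : set A) (f : A -> B) (B1 B0 : set B) (g : B -> C) (C0 : set C) :
    Prop :=
  forall y, B1 y -> (C0 (g y) <-> exists2 x, A1 x & B0 (y - f x)).

Section Koszul.
Variables (M : lmodType R) (F : minimal_free_resolution M).

(* The term of homological degree n of lin_j(F) is the quotient of
   lin_num j n by lin_den j n; it is 0 when n > j. *)
Definition lin_num (j n : nat) : set 'rV[R]_(betti F n) :=
  if (n <= j)%N then mpow (j - n) _ else [set 0].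
Definition lin_den (j n : nat) : set 'rV[R]_(betti F n) :=
  if (n <= j)%N then mpow (j.+1 - n) _ else [set 0].
Arguments lin_num j n : clear implicits.
Arguments lin_den j n : clear implicits.

Definition lin_acyclic (j : nat) : Prop :=
  [/\ (* at m^j M / m^(j+1) M *)
      exact_subquotient (lin_num j 0) (aug F) (mpow j M) (mpow j.+1 M)
        (fun _ : M => 0 : M) [set 0],
      exact_subquotient (lin_num j 1) (diff F 0) (lin_num j 0) (lin_den j 0)
        (aug F) (mpow j.+1 M) &
      forall n,
        exact_subquotient (lin_num j n.+2) (diff F n.+1)
          (lin_num j n.+1) (lin_den j n.+1) (diff F n) (lin_den j n)].

End Koszul.

Definition koszul M : Prop :=
  exists F : minimal_free_resolution M, forall j, lin_acyclic F j.

End OverLocalRing.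
End Modules.

Arguments mpow {R} m n M.
Arguments lin_num {R m M} F j n.
Arguments lin_den {R m M} F j n.

(* Main.v *)
Require Import Defs.
From HB Require Import structures.
From mathcomp Require Import all_boot all_order all_algebra.
From mathcomp Require Import boolp classical_sets functions.
From mathcomp Require Import zify.

Set Implicit Arguments.
Unset Strict Implicit.
Unset Printing Implicit Defensive.

Import GRing.Theory.
Local Open Scope classical_set_scope.
Local Open Scope ring_scope.

(* A dimension shift along the finite injective resolution of R shows that R is
   self-injective, whence soc R = m^2 = Rs is simple.  Let M be finite with
   syzygies L_0 = M, L_1, L_2, ...  As m^3 = 0, exactness of the linear strands at
   m^i F_n / m^(i+1) F_n is automatic except for i = 0 < n and for i = 2, where it
   means that soc L_n, respectively soc L_(n+1), is contained in m L_n, respectively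
   m L_(n+1).  So M is Koszul if and only if k is not a direct summand of any L_n
   with n >= 1.

   Self-injectivity makes Hom(-,R) exact, so N_n = Hom(Omega_n(k),R) is an n-th
   cosyzygy of Hom(k,R) = k.  If N is a retract of M, then lifting to the minimal
   covers, the composite is unipotent because m is nilpotent, so the syzygy of N is
   a retract of that of M; conversely, retractions of syzygies extend by
   self-injectivity to the covers, hence to the cosyzygies.  Therefore k is a direct
   summand of L_n if and only if N_n is a direct summand of M.

   When soc L_j is in mL_j, counting ranks in mF/m^2F for the cover F of L_{j-1} gives
   e beta_j = beta_{j-1} + beta_{j+1}.  For M = k this gives beta_n = b_n and the
   Hilbert series of N_i; for a Koszul M with H_M = b_{i-1} + b_i t the Betti numbers
   would run through b backwards and become negative. *)

(** * Linear maps and retracts *)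

Section LinearMaps.
Variable R : comNzRingType.
Implicit Types U V W : lmodType R.

Lemma linear_build U V (f : U -> V) :
  linear f -> exists g : {linear U -> V}, g =1 f.
Proof.
move=> lf; pose fL := GRing.isLinear.Build _ _ _ _ f lf.
by pose g : {linear U -> V} := HB.pack f fL; exists g.
Qed.

Lemma linear_inj U V (f : {linear U -> V}) :
  (forall x, f x = 0 -> x = 0) -> injective f.
Proof.
move=> f0 x y fxy; apply/eqP; rewrite -subr_eq0; apply/eqP/f0.
by rewrite linearB fxy subrr.
Qed.

Lemma factor_surj U V W (p : {linear U -> V}) (h : {linear U -> W}) :
    (forall y, exists x, p x = y) -> (forall x, p x = 0 -> h x = 0) ->
  exists k : {linear V -> W}, forall x, k (p x) = h x.
Proof.
move=> /choice[q pq] kerp.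
have hq x y : p x = p y -> h x = h y.
  move=> pxy; apply/eqP; rewrite -subr_eq0 -linearB; apply/eqP.
  by apply: kerp; rewrite linearB pxy subrr.
have [a x y|k kE] := @linear_build V W (h \o q).
  by rewrite /= -linearP; apply: hq; rewrite linearP /= !pq.
by exists k => x; rewrite kE; apply: hq.
Qed.

Lemma factor_inj U V W (i : {linear U -> V}) (h : {linear W -> V}) :
    injective i -> (forall x, exists y, i y = h x) ->
  exists k : {linear W -> U}, forall x, i (k x) = h x.
Proof.
move=> inji /choice[q iq].
have [a x y|k kE] := @linear_build W U q.
  by apply: inji; rewrite linearP !iq linearP.
by exists k => x; rewrite kE.
Qed.

Lemma quotient_map V (N : submodule V) :
  exists p : {linear V -> quotient N},
    (forall y, exists x, p x = y) /\ (forall x, p x = 0 <-> submodule_set N x).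
Proof.
have [a x y|p pE] := @linear_build V (quotient N) (\pi_(quotient N))%qT.
  by rewrite [LHS]pi_quo_add [X in quo_add X _]pi_quo_scale.
exists p; split=> [y|x]; first by exists (repr y); rewrite pE reprK.
have -> : 0 = p 0 by rewrite linear0.
by rewrite !pE (quo_eqP N x 0) subr0.
Qed.

Lemma free_map p V (y : 'I_p -> V) :
  exists g : {linear 'rV[R]_p -> V}, forall v, g v = \sum_j v 0 j *: y j.
Proof.
apply: linear_build => a u v; rewrite scaler_sumr -big_split /=.
by apply: eq_bigr => j _; rewrite !mxE scalerA scalerDl.
Qed.

Lemma free_mapE p V (h : {linear 'rV[R]_p -> V}) v :
  h v = \sum_j v 0 j *: h (delta_mx 0 j).
Proof.
rewrite {1}[v]row_sum_delta linear_sum /=.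
by apply: eq_bigr => j _; rewrite linearZ.
Qed.

Lemma free_lift p U V (f : {linear U -> V}) (h : {linear 'rV[R]_p -> V}) :
  (forall y, exists x, f x = y) ->
  exists g : {linear 'rV[R]_p -> U}, forall v, f (g v) = h v.
Proof.
move=> /choice[q fq]; have [g gE] := free_map (fun j => q (h (delta_mx 0 j))).
exists g => v; rewrite gE linear_sum [RHS]free_mapE /=.
by apply: eq_bigr => j _; rewrite linearZ fq.
Qed.

(** Submodules here are sets, whereas [injective_module] speaks of module types. The quotient of [U]
    by the kernel realises the image of [f] as such a type; this is how the ideal m becomes a
    module. *)
Lemma image_factor U V (f : {linear U -> V}) :
  exists (A : lmodType R) (p : {linear U -> A}) (i : {linear A -> V}),
    [/\ forall y, exists x, p x = y, injective i & forall x, i (p x) = f x].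
Proof.
have kerP : is_submodule [set x | f x = 0].
  by split=> [|a x y /= fx fy]; rewrite /= ?linear0 // linearP fx fy scaler0 addr0.
have [p [psurj pker]] := quotient_map (Submodule kerP).
have [x /pker //|i iE] := @factor_surj _ _ _ p f psurj.
exists _, p, i; split=> // y z; have [x <-] := psurj y; have [w <-] := psurj z.
rewrite !iE => fxw; apply/eqP; rewrite -subr_eq0 -linearB; apply/eqP/pker => /=.
by rewrite linearB fxw subrr.
Qed.

Lemma bijective_inj_surj (U V : Type) (f : U -> V) :
  injective f -> (forall y, exists x, f x = y) -> bijective f.
Proof.
move=> injf /choice[g fg]; exists g => // x; exact/injf/fg.
Qed.

(** Direct summands without a complement: only two maps have to be transported along lifts and
    extensions. *)
Definition retract U V : Prop :=
  exists (f : {linear U -> V}) (g : {linear V -> U}), forall x, g (f x) = x.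

Lemma retract_trans U V W : retract U V -> retract V W -> retract U W.
Proof.
move=> [f [g gf]] [h [k kh]]; exists (h \o f), (g \o k) => x /=.
by rewrite kh gf.
Qed.

Lemma bij_linear_inv U V (f : {linear U -> V}) :
  bijective f -> exists g : {linear V -> U}, cancel f g /\ cancel g f.
Proof.
case=> g fK gK; have [a x y|h hE] := @linear_build V U g.
  by apply: (can_inj fK); rewrite linearP !gK.
by exists h; split=> x; rewrite hE.
Qed.

Lemma isomorphic_retract U V : isomorphic U V -> retract U V /\ retract V U.
Proof.
move=> [f /bij_linear_inv[g [fK gK]]].
by split; [exists f, g | exists g, f].
Qed.

Lemma isomorphic_sym U V : isomorphic U V -> isomorphic V U.
Proof. by move=> [f /bij_linear_inv[g [fK gK]]]; exists g, f. Qed.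

Lemma isomorphic_trans U V W :
  isomorphic U V -> isomorphic V W -> isomorphic U W.
Proof. by move=> [f bf] [g bg]; exists (g \o f); exact: bij_comp. Qed.

(** The complement of the image of the section [f] is [coker f], with y sent to the pair (g y, class
    of y). *)
Lemma direct_summandP U V : direct_summand U V <-> retract U V.
Proof.
split=> [[W /isomorphic_sym[f /bij_linear_inv[g [fK gK]]]]|[f [g gf]]].
  have [a x y|i iE] := @linear_build U V (fun x => f (x, 0)).
    rewrite -linearP; congr (f _); apply: injective_projections => //=.
    by rewrite scaler0 addr0.
  have [a x y|p pE] := @linear_build V U (fun y => (g y).1).
    by rewrite linearP.
  by exists i, p => x; rewrite pE iE fK.
have [p [psurj pker]] := quotient_map (Submodule (range_is_submodule f)).
have [a x y|h hE] := @linear_build V (U * coker f)%type (fun y => (g y, p y)).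
  by rewrite !linearP.
exists (coker f), h; apply: bijective_inj_surj => [|[u z]].
  apply: linear_inj => y; rewrite hE => -[gy0 /pker[x _ fx]].
  by rewrite -fx -(gf x) fx gy0 linear0.
(* Adding an element of the range of [f] corrects the first coordinate to [u] and leaves the class
   unchanged. *)
have [y <-] := psurj z; exists (y + f (u - g y)); rewrite hE; congr (_, _).
  by rewrite linearD /= gf addrC subrK.
rewrite linearD /=; suff -> : p (f (u - g y)) = 0 by rewrite addr0.
by apply/pker; exists (u - g y).
Qed.

End LinearMaps.

(** * Powers of the maximal ideal *)

Section IdealPowers.
Variables (R : comNzRingType) (m : ideal R).
Implicit Types U V M : lmodType R.
Local Notation in_m := (submodule_set m).

Lemma mpow_ind n M (P : M -> Prop) :
    P 0 -> (forall x y, P x -> P y -> P (x + y)) ->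
    (forall a x, in_m a -> mpow m n M x -> P (a *: x)) ->
  forall x, mpow m n.+1 M x -> P x.
Proof.
move=> P0 PD PZ _ [k [a [x [ma Nx ->]]]].
by apply: (big_ind P) => // i _; apply: PZ; [exact: ma|exact: Nx].
Qed.

Lemma mpowS n M a x : in_m a -> mpow m n M x -> mpow m n.+1 M (a *: x).
Proof.
move=> ma Nx; exists 1%N, (fun=> a), (fun=> x).
by split=> //; rewrite big_ord1.
Qed.

Lemma mpow_submod n M : is_submodule (mpow m n M).
Proof.
case: n => [//|n].
have D x y : mpow m n.+1 M x -> mpow m n.+1 M y -> mpow m n.+1 M (x + y).
  move=> [k [a [u [ma Nu ->]]]] [l [b [v [mb Nv ->]]]].
  exists (k + l)%N,
    (fun i : 'I_(k + l) =>
       match fintype.split i with inl i => a i | inr j => b j end),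
    (fun i : 'I_(k + l) =>
       match fintype.split i with inl i => u i | inr j => v j end).
  split=> [i|i|]; first by case: fintype.split.
    by case: fintype.split => j; [exact: Nu|exact: Nv].
  rewrite big_split_ord; congr (_ + _); apply: eq_bigr => i _.
    by rewrite -[lshift l i]/(unsplit (inl i)) unsplitK.
  by rewrite -[rshift k i]/(unsplit (inr i)) unsplitK.
split.
  by exists 0%N, (fun=> 0), (fun=> 0); split=> [[]|[]|] //; rewrite big_ord0.
move=> a x y Nx Ny; apply: (D) => //.
move: x Nx {y Ny}; apply: mpow_ind => [|x y Nx Ny|b x mb Nx].
- by rewrite scaler0 -[0](scale0r 0); apply: mpowS;
    [exact: sub_mem0|case: (n) => //= k;
     exists 0%N, (fun=> 0), (fun=> 0); split=> [[]|[]|] //; rewrite big_ord0].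
- by rewrite scalerDr; exact: (D).
- by rewrite scalerA; apply: mpowS => //; exact: (sub_memZ (N := m)).
Qed.

Definition mpow_module n M : submodule M := Submodule (mpow_submod n M).

Lemma mpow_mem0 n M : mpow m n M 0. Proof. exact: (sub_mem0 (mpow_module n M)). Qed.
Lemma mpow_memD n M x y : mpow m n M x -> mpow m n M y -> mpow m n M (x + y).
Proof. exact: (@sub_memD _ _ (mpow_module n M)). Qed.
Lemma mpow_memZ n M a x : mpow m n M x -> mpow m n M (a *: x).
Proof. exact: (@sub_memZ _ _ (mpow_module n M)). Qed.
Lemma mpow_memN n M x : mpow m n M x -> mpow m n M (- x).
Proof. exact: (@sub_memN _ _ (mpow_module n M)). Qed.
Lemma mpow_memB n M x y : mpow m n M x -> mpow m n M y -> mpow m n M (x - y).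
Proof. by move=> Nx Ny; apply: mpow_memD => //; exact: mpow_memN. Qed.
Lemma mpow_sum n M (I : finType) (F : I -> M) :
  (forall i, mpow m n M (F i)) -> mpow m n M (\sum_i F i).
Proof.
move=> NF; apply: (big_ind (mpow m n M)) => // [|x y Nx Ny].
  exact: mpow_mem0.
exact: mpow_memD.
Qed.

Lemma mpow_dec n M x : mpow m n.+1 M x -> mpow m n M x.
Proof.
elim: n x => [//|n IH]; apply: mpow_ind => [|x y Nx Ny|a x ma /IH].
- exact: mpow_mem0.
- exact: mpow_memD.
- exact: mpowS.
Qed.

Lemma mpow_le n k M x : (n <= k)%N -> mpow m k M x -> mpow m n M x.
Proof.
by move/subnK <-; elim: (k - n)%N => // l IH; rewrite addSn => /mpow_dec/IH.
Qed.

Lemma mpow_linear n U V (f : {linear U -> V}) x :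
  mpow m n U x -> mpow m n V (f x).
Proof.
elim: n x => // n IH; apply: mpow_ind => [|x y Nx Ny|a x ma /IH].
- by rewrite linear0; exact: mpow_mem0.
- by rewrite linearD; exact: mpow_memD.
- by rewrite linearZ; exact: mpowS.
Qed.

Lemma mpow_surj n U V (f : {linear U -> V}) :
    (forall y, exists x, f x = y) ->
  forall y, mpow m n V y -> exists2 x, mpow m n U x & f x = y.
Proof.
move=> fsurj; elim: n => [|n IH]; first by move=> y _; have [x] := fsurj y; exists x.
apply: mpow_ind => [|_ _ [x Nx <-] [y Ny <-]|a _ ma /IH[x Nx <-]].
- by exists 0; [exact: mpow_mem0|rewrite linear0].
- by exists (x + y); [exact: mpow_memD|rewrite linearD].
- by exists (a *: x); [exact: mpowS|rewrite linearZ].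
Qed.

Lemma mpow_raise n k U V (f : {linear U -> V}) :
    (forall x, mpow m k V (f x)) ->
  forall x, mpow m n U x -> mpow m (n + k) V (f x).
Proof.
move=> fm; elim: n => [x _|n IH]; first exact: fm.
apply: mpow_ind => [|x y Nx Ny|a x ma /IH].
- by rewrite linear0; exact: mpow_mem0.
- by rewrite linearD; exact: mpow_memD.
- by rewrite linearZ; exact: mpowS.
Qed.

Lemma mpow1_ring a : mpow m 1 R^o a <-> in_m a.
Proof.
split; last by move=> ma; rewrite -[a]mulr1; exact: (mpowS (M := R^o)).
move: a; apply: mpow_ind => [|x y|a x ma _]; [exact: sub_mem0|exact: sub_memD|].
by rewrite -[_ *: _]mulrC; exact: (sub_memZ (N := m) x).
Qed.

Lemma mpow_smul n k M a x :
  mpow m n R^o a -> mpow m k M x -> mpow m (n + k) M (a *: x).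
Proof.
move=> Na Nx; have [c u v|f fE] := @linear_build R R^o M (fun c => c *: x).
  by rewrite scalerDl scalerA.
elim: n a Na => [a _|n IH]; first exact: mpow_memZ.
apply: mpow_ind => [|a b Na Nb|a b ma /IH Nb].
- by rewrite scale0r; exact: mpow_mem0.
- by rewrite scalerDl; exact: mpow_memD.
- by rewrite -scalerA; exact: mpowS.
Qed.

Lemma mpow_row n p (v : 'rV[R]_p) :
  mpow m n _ v <-> forall j, mpow m n R^o (v 0 j).
Proof.
split=> [Nv j|Nv].
  have [a x y|f fE] := @linear_build R 'rV[R]_p R^o (fun v => v 0 j).
    by rewrite !mxE.
  by rewrite -fE; exact: mpow_linear.
rewrite [v]row_sum_delta; apply: mpow_sum => j.
by rewrite -[n]addn0; exact: mpow_smul.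
Qed.

End IdealPowers.

(** With d = u - 1 and d^3 = 0, the inverse of u = 1 + d is 1 - d + d^2. *)
Lemma unipotent_retract (R : comNzRingType) (U : lmodType R) (u : {linear U -> U}) :
    (forall x, let d y := u y - y in d (d (d x)) = 0) ->
  exists w : {linear U -> U}, forall x, w (u x) = x.
Proof.
move=> d3; have [a x y|d dE] := @linear_build R U U (fun x => u x - x).
  by rewrite /= [u _]linearP scalerBr opprD addrACA.
have [a x y|w wE] := @linear_build R U U (fun x => x - d x + d (d x)).
  by rewrite /= (linearP d a x) (linearP d a (d x)) !scalerDr scalerN opprD
    [X in X + _]addrACA [LHS]addrACA.
exists w => x; have uE : u x = x + d x by rewrite dE addrC subrK.
have d3x : d (d (d x)) = 0 by rewrite !dE; exact: d3.
by rewrite wE uE !(linearD d) d3x opprD !addrA addrK addr0 subrK.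
Qed.

(** * Local rings with m^3 = 0 *)

Section LocalRing.
Variables (R : comNzRingType) (m : ideal R).
Local Notation in_m := (submodule_set m).
Hypotheses (locR : local_ring m) (m3 : mpow m 3 R^o = [set 0]).

Lemma one_notin : ~ in_m 1.
Proof. by case: locR => _ []. Qed.

Lemma mul3_eq0 a b c : in_m a -> in_m b -> in_m c -> a * (b * c) = 0.
Proof.
move=> ma mb mc; have : mpow m 3 R^o (a * (b * c)).
  by do 2!apply: (mpowS (M := R^o)) => //; apply/mpow1_ring.
by rewrite m3.
Qed.

(** The hypothesis m^3 = 0 is about the ring. Regrouping products shows that mM is killed by
    products of two elements of m, then that m^2 M is killed by m. *)
Lemma mpow_ge3_eq0 n (M : lmodType R) (x : M) : (3 <= n)%N -> mpow m n M x -> x = 0.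
Proof.
move=> /mpow_le /[apply]; move: x.
have H1 x : mpow m 1 M x -> forall a b, in_m a -> in_m b -> a *: (b *: x) = 0.
  move: x; apply: mpow_ind => [|x y IHx IHy|c x mc _] a b ma mb.
  - by rewrite !scaler0.
  - by rewrite !scalerDr IHx ?IHy ?addr0.
  - by rewrite !scalerA -mulrA mul3_eq0 ?scale0r.
have H2 x : mpow m 2 M x -> forall a, in_m a -> a *: x = 0.
  move: x; apply: mpow_ind => [|x y IHx IHy|c x mc /H1 xP] a ma.
  - by rewrite scaler0.
  - by rewrite scalerDr IHx ?IHy ?addr0.
  - exact: xP.
by apply: mpow_ind => [//|x y -> ->|c x mc /H2 ->//]; rewrite addr0.
Qed.

(** Maximality gives 1 = x + ca with x in m. Since x^3 = 0, the inverse of ca = 1 - x is 1 + x +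
    x^2. *)
Lemma notin_unit a : ~ in_m a -> exists c, c * a = 1.
Proof.
move=> ma; have [_ [_ maxm] _] := locR.
pose J := [set y : R^o | exists x c : R, in_m x /\ y = x + c * a].
have Jsub : is_submodule J.
  split; first by exists 0, 0; split; [exact: sub_mem0|rewrite mul0r addr0].
  move=> r _ _ [x [c [mx ->]]] [y [d [my ->]]]; exists (r * x + y), (r * c + d).
  split; first by apply: sub_memD => //; exact: (sub_memZ (N := m)).
  by rewrite -[_ *: _]/(r * _) mulrDl mulrDr addrACA mulrA.
have mJ : in_m `<=` J by move=> x mx; exists x, 0; split=> //; rewrite mul0r addr0.
have [J1|nJ1] := pselect (J 1); last first.
  case: ma; rewrite -(maxm (Submodule Jsub)) //=.
  by exists 0, 1; split; [exact: sub_mem0|rewrite mul1r add0r].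
have [x [c [mx E]]] := J1; exists ((1 + x + x * x) * c).
have x3 := mul3_eq0 mx mx mx.
have ca : c * a = 1 - x by rewrite [X in X - x]E addrC addKr.
rewrite -mulrA ca.
rewrite mulrBr mulr1 !mulrDl mul1r -[x * x * x]mulrA x3 addr0.
by rewrite -[1 + x + _]addrA addrK.
Qed.

End LocalRing.

(** * Extension of linear maps *)

Section Injectivity.
Variables (R : comNzRingType) (m : ideal R).
Local Notation in_m := (submodule_set m).
Hypotheses (locR : local_ring m) (m3 : mpow m 3 R^o = [set 0]).

(** A partial linear map is encoded as a total function that is constrained on [A] only, so
    enlarging the domain changes no types. *)
Definition linear_on (B E : lmodType R) (A : set B) (g : B -> E) : Prop :=
  forall a x y, A x -> A y -> g (a *: x + y) = a *: g x + g y.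

(* Baer's condition for the single ideal m: if C = E, it says Ext^1(k, E) = 0. *)
Definition extends_from_m (E : lmodType R) (C : set E) : Prop :=
  forall phi : R -> E, linear_on (in_m : set R^o) phi ->
    (forall a, in_m a -> C (phi a)) ->
  exists2 x, C x & forall a, in_m a -> phi a = a *: x.

(** Finitely many generators present m as the image of a map from a free module to R. Extending from
    that image to R and evaluating at 1 gives the representing element. *)
Lemma injective_extends_from_m (E : lmodType R) :
  injective_module E -> extends_from_m [set: E].
Proof.
have [noethR _ _] := locR => injE phi phiL _.
have [n [x xE]] := noethR m; have [X XE] := free_map (x : 'I_n -> R^o).
have mX a : in_m a <-> exists v, X v = a.
  rewrite xE; split=> [[c _ <-]|[v <-]]; last by exists (v 0); rewrite ?XE.
  exists (\row_i c i); rewrite XE.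
  by apply: eq_bigr => i _; rewrite mxE.
have [A [p [i [psurj iinj ip]]]] := image_factor X.
have mi y : in_m (i y) by have [v <-] := psurj y; rewrite ip mX; exists v.
have [a y z|g gE] := @linear_build R A E (fun y => phi (i y)).
  by rewrite linearP phiL.
have [h hE] := injE A R^o i g iinj.
exists (h 1) => // a ma; have /mX[v va] := ma.
by rewrite -va -ip -gE -hE -linearZ -[_ *: 1]/(_ * 1) mulr1.
Qed.

Section Extension.
Variables (B E : lmodType R) (C : submodule E).
Hypothesis C_ext : extends_from_m (submodule_set C).
Implicit Types (A : submodule B) (g : B -> E).

Definition partial_map A g : Prop :=
  linear_on (submodule_set A) g /\ forall x, submodule_set A x -> submodule_set C (g x).

Definition partial_ext A g A' g' : Prop :=
  [/\ partial_map A' g', submodule_set A `<=` submodule_set A' &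
      forall x, submodule_set A x -> g' x = g x].

Lemma partial_map0 A g : partial_map A g -> g 0 = 0.
Proof.
move=> [gL _]; have := gL 1 0 0 (sub_mem0 A) (sub_mem0 A).
by rewrite !scale1r addr0 -{1}[g 0]addr0 => /addrI.
Qed.

Lemma partial_mapB A g x y : partial_map A g ->
  submodule_set A x -> submodule_set A y -> g (x - y) = g x - g y.
Proof.
move=> gA Ax Ay; have [gL _] := gA.
by rewrite -scaleN1r addrC gL // scaleN1r addrC.
Qed.

Lemma partial_ext_refl A g : partial_map A g -> partial_ext A g A g.
Proof. by split. Qed.

Lemma partial_ext_trans A g A1 g1 A2 g2 :
  partial_ext A g A1 g1 -> partial_ext A1 g1 A2 g2 -> partial_ext A g A2 g2.
Proof.
move=> [_ A01 g01] [pm A12 g12]; split=> // x Ax; first exact/A12/A01.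
by rewrite g12 ?g01 //; exact: A01.
Qed.

(** If x0 is outside [A], then the ideal of all c with c x0 in [A] is exactly m: it contains m, and
    a unit in it would put x0 in [A]. So the extension condition for m alone suffices. *)
Lemma partial_ext1 A g x0 :
    partial_map A g -> (forall a, in_m a -> submodule_set A (a *: x0)) ->
  exists A' g', partial_ext A g A' g' /\ submodule_set A' x0.
Proof.
move=> gA mx0; have [gL gC] := gA.
have [Ax0|nAx0] := pselect (submodule_set A x0); first by exists A, g; split=> //; exact: partial_ext_refl.
have inm c : submodule_set A (c *: x0) -> in_m c.
  move=> Acx; have [//|/(notin_unit locR m3)[d dc]] := pselect (in_m c).
  by case: nAx0; rewrite -(scale1r x0) -dc -scalerA; exact: sub_memZ.
have [a x y mx my||e Ce eE] := C_ext (phi := fun a => g (a *: x0)).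
- by rewrite scalerDl -scalerA gL //; exact: mx0.
- by move=> a ma; exact/gC/mx0.
pose A' := [set y | exists z c, submodule_set A z /\ y = z + c *: x0].
have A'sub : is_submodule A'.
  split; first by exists 0, 0; split; [exact: sub_mem0|rewrite scale0r addr0].
  move=> a _ _ [z [c [Az ->]]] [t [d [At ->]]]; exists (a *: z + t), (a * c + d).
  split; first by apply: sub_memD => //; exact: sub_memZ.
  by rewrite scalerDr scalerDl scalerA addrACA.
(* The value g z + c e does not depend on the decomposition: if z + c x0 = t + d x0 then (c - d) x0
   lies in [A], so c - d is in m, where [e] computes [g]. *)
have /choice[g' g'P] : forall y, exists v, forall z c, submodule_set A z ->
    y = z + c *: x0 -> v = g z + c *: e.
  move=> y; have [[z [c [Az ->]]]|nAy] := pselect (A' y); last first.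
    by exists 0 => z c Az yE; case: nAy; exists z, c.
  exists (g z + c *: e) => t d At /eqP; rewrite -subr_eq0 opprD addrACA.
  rewrite -scalerBl addr_eq0 => /eqP ztE; apply/eqP; rewrite -subr_eq0.
  rewrite opprD addrACA -scalerBl -(partial_mapB gA) // ztE.
  have mcd : in_m (c - d).
    apply: inm; rewrite -[_ *: _]opprK -ztE.
    by apply: sub_memN; apply: sub_memD => //; exact: sub_memN.
  by rewrite -scaleNr eE ?scaleNr ?addNr //; exact: (sub_memN (N := m)).
have g'E z c : submodule_set A z -> g' (z + c *: x0) = g z + c *: e.
  by move=> Az; exact: g'P.
exists (Submodule A'sub), g'; split; last first.
  by exists 0, 1; split; [exact: sub_mem0|rewrite scale1r add0r].
split=> [|x Ax|x Ax].
- split=> [a _ _ [z [c [Az ->]]] [t [d [At ->]]]|_ [z [c [Az ->]]]].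
    rewrite !g'E // !scalerDr !scalerA [LHS](_ : _ = g' (a *: z + t + (a * c + d) *: x0)).
      by rewrite g'E ?gL // ?scalerDl 1?addrACA //; apply: sub_memD => //; exact: sub_memZ.
    by rewrite scalerDl addrACA.
  by rewrite g'E //; apply: sub_memD; [exact: gC|exact: sub_memZ].
- by exists x, 0; rewrite scale0r addr0.
- by rewrite -[x in LHS]addr0 -(scale0r x0) g'E // scale0r addr0.
Qed.

(** Adjoins a finite list one element at a time; [P] is monotone so that it still holds for the
    later elements once the domain has grown. *)
Lemma partial_ext_seq (P : submodule B -> B -> Prop) :
    (forall A A' x, submodule_set A `<=` submodule_set A' -> P A x -> P A' x) ->
    (forall A g x, partial_map A g -> P A x ->
       exists A' g', partial_ext A g A' g' /\ submodule_set A' x) ->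
  forall (l : seq B) A g, partial_map A g -> (forall x, x \in l -> P A x) ->
  exists A' g', partial_ext A g A' g' /\ forall x, x \in l -> submodule_set A' x.
Proof.
move=> Pmono Pext; elim=> [|x l IH] A g gA lP.
  by exists A, g; split=> //; exact: partial_ext_refl.
have [A1 [g1 [ext1 A1x]]] := Pext A g x gA (lP x (mem_head _ _)).
have [g1A AA1 _] := ext1.
have [y yl|A2 [g2 [ext2 A2l]]] := IH A1 g1 g1A.
  by apply: (Pmono A) => //; apply: lP; rewrite inE yl orbT.
exists A2, g2; split; first exact: partial_ext_trans ext1 ext2.
move=> y; rewrite inE => /orP[/eqP ->|]; last exact: A2l.
by have [_ A12 _] := ext2; exact: A12.
Qed.

(** Induction on [k]. The products y_i x with the generators y_i of m satisfy the hypothesis for the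
    smaller exponent; once they are adjoined, m x lies in the domain and x itself can be added. *)
Lemma partial_ext_mpow k A g x :
    partial_map A g -> (forall c, mpow m k R^o c -> submodule_set A (c *: x)) ->
  exists A' g', partial_ext A g A' g' /\ submodule_set A' x.
Proof.
elim: k A g x => [|k IH] A g x gA Ax.
  exists A, g; split; first exact: partial_ext_refl.
  by rewrite -(scale1r x); exact: Ax.
have [noethR _ _] := locR; have [n [y yE]] := noethR m.
have my i : in_m (y i).
  rewrite yE; exists (fun j => (j == i)%:R) => //.
  rewrite (bigD1 i) //= eqxx scale1r big1 ?addr0 // => j /negPf ->.
  by rewrite scale0r.
have [|z /mapP[i _ ->] c kc|A1 [g1 [ext1 A1y]]] := partial_ext_seq
    (P := fun A x => forall c, mpow m k R^o c -> submodule_set A (c *: x))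
    _ IH (l := [seq (y i : R) *: x | i <- enum 'I_n]) gA.
- by move=> A1 A2 z A12 Az c /Az/A12.
- rewrite scalerA; apply: Ax; rewrite -addn1.
  by apply: mpow_smul => //; apply/mpow1_ring.
have [g1A AA1 _] := ext1.
have [a|A2 [g2 [ext2 A2x]]] := partial_ext1 (x0 := x) g1A.
  rewrite yE => -[c _ <-]; rewrite scaler_suml.
  apply: (big_ind (submodule_set A1)) => [|u v|i _]; [exact: sub_mem0|exact: sub_memD|].
  by rewrite -scalerA; apply/sub_memZ/A1y/map_f; rewrite mem_enum.
by exists A2, g2; split=> //; exact: partial_ext_trans ext1 ext2.
Qed.

(** Baer's criterion, with finite generation of [B] in place of Zorn's lemma: m^3 = 0 makes the
    previous lemma applicable to every generator with exponent 3. Keeping the values in [C] allows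
    [C] to be the image of a differential. *)
Lemma extends_from_m_inj (A : lmodType R) (i : {linear A -> B}) (h : {linear A -> E}) :
    finite_module B -> injective i -> (forall x, submodule_set C (h x)) ->
  exists H : {linear B -> E},
    (forall x, H (i x) = h x) /\ forall y, submodule_set C (H y).
Proof.
move=> [n [y yE]] iinj hC; pose A0 := Submodule (range_is_submodule i).
have /choice[g gP] : forall z, exists v, forall x, i x = z -> v = h x.
  move=> z; have [[x ix]|nx] := pselect (exists x, i x = z).
    by exists (h x) => x'; rewrite -ix => /iinj ->.
  by exists 0 => x ix; case: nx; exists x.
have gA : partial_map A0 g.
  split=> [a _ _ [x _ <-] [t _ <-]|_ [x _ <-]].
    by rewrite -linearP !(gP _ _ erefl) linearP.
  by rewrite (gP _ _ erefl).
have [|z _ c|A' [g' [ext A'y]]] := partial_ext_seq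
    (P := fun A x => forall c, mpow m 3 R^o c -> submodule_set A (c *: x))
    _ (@partial_ext_mpow 3) (l := [seq y i | i <- enum 'I_n]) gA.
- by move=> A1 A2 z A12 Az c /Az/A12.
- by rewrite m3 => ->; rewrite scale0r; exact: sub_mem0.
have A'T z : submodule_set A' z.
  have : [set: B] z by []; rewrite yE => -[c _ <-].
  apply: (big_ind (submodule_set A')) => [|u v|j _]; [exact: sub_mem0|exact: sub_memD|].
  by apply/sub_memZ/A'y/map_f; rewrite mem_enum.
have [[g'L g'C] _ gg'] := ext.
have [a x z|H HE] := @linear_build R B E g'; first exact: g'L.
exists H; split=> [x|z]; rewrite HE; last exact: g'C.
by rewrite gg'; [exact: gP|exists x].
Qed.
End Extension.
End Injectivity.

(** * Self-injectivity and the socle *)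

Section Gorenstein.
Variables (R : comNzRingType) (m : ideal R).
Local Notation in_m := (submodule_set m).

Lemma finite_ring : finite_module R^o.
Proof.
exists 1%N, (fun=> 1); apply/seteqP; split=> [c _|//].
by exists (fun=> c) => //; rewrite big_ord1 -[_ *: _]/(_ * _) mulr1.
Qed.

Lemma finite_free p : finite_module 'rV[R]_p.
Proof.
exists p, (fun j => delta_mx 0 j); apply/seteqP; split=> [v _|//].
by exists (fun j => v 0 j) => //; rewrite -row_sum_delta.
Qed.

Lemma module_setT (V : lmodType R) : is_submodule [set: V].
Proof. by []. Qed.

Section Short.
Hypotheses (locR : local_ring m) (m3 : mpow m 3 R^o = [set 0]).

(** Take a nonzero element of the last nonzero power of m: of m^2, else of m, else 1. *)
Lemma socle_neq0 : exists2 s : R, s != 0 & forall a, in_m a -> a * s = 0.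
Proof.
have [[a [b [ma mb ab]]]|nab] :=
    pselect (exists a b, [/\ in_m a, in_m b & a * b != 0]).
  by exists (a * b) => // c mc; exact: (mul3_eq0 m3).
have [[a [ma a0]]|na] := pselect (exists a, in_m a /\ a != 0).
  exists a => // c mc; apply/eqP/negPn/negP => ca.
  by apply: nab; exists c, a.
exists 1 => [|c mc]; first exact: oner_neq0.
by apply/eqP/negPn/negP; rewrite mulr1 => c0; apply: na; exists c.
Qed.

Lemma socle_annihilator s : s != 0 -> (forall a, in_m a -> a * s = 0) ->
  forall a, a * s = 0 <-> in_m a.
Proof.
move=> s0 ms a; split=> [as0|/ms //]; have [//|/(notin_unit locR m3)[c ca]] := pselect (in_m a).
by case/eqP: s0; rewrite -(mul1r s) -ca -mulrA as0 mulr0.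
Qed.

(** Both Rs and Ru are images of k, so s |-> u defines a map from Rs. Its extension to R sends 1 to
    the required [w]. *)
Lemma socle_divide (E : lmodType R) (C : submodule E) s u :
    extends_from_m m (submodule_set C) ->
    s != 0 -> (forall a, in_m a -> a * s = 0) ->
    submodule_set C u -> (forall a, in_m a -> a *: u = 0) ->
  exists2 w, submodule_set C w & s *: w = u.
Proof.
move=> Cext s0 ms Cu mu; have sann := socle_annihilator s0 ms.
have [p [psurj pker]] := quotient_map m.
have [a x y|f fE] := @linear_build R R^o R^o (fun a => a * s).
  by rewrite mulrDl -[_ *: _]/(_ * _) -mulrA.
have [a x y|g gE] := @linear_build R R^o E (fun a => a *: u).
  by rewrite scalerDl -scalerA.
have [x /pker mx|i ip] := @factor_surj _ _ _ _ p f psurj; first by rewrite fE ms.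
have [x /pker mx|h hp] := @factor_surj _ _ _ _ p g psurj; first by rewrite gE mu.
have iinj : injective i.
  apply: linear_inj => y; have [x <-] := psurj y; rewrite ip fE => /sann mx.
  exact/pker.
have [|H [Hi HC]] := extends_from_m_inj locR m3 Cext (h := h) finite_ring iinj.
  by move=> y; have [x <-] := psurj y; rewrite hp gE; exact: sub_memZ.
exists (H 1) => //; rewrite -linearZ -[_ *: 1]/(s * 1) mulr1.
by have := Hi (p 1); rewrite ip hp fE gE mul1r scale1r.
Qed.

(* If [phi : m -> ker d] is [a |-> a *: x], then [d x] is killed by [m], so that
   [d x = s *: d v] for a socle element [s], and [x - s *: v] also represents [phi]. *)
Lemma extends_from_m_ker (E E' : lmodType R) (d : {linear E -> E'}) :
    extends_from_m m [set: E] -> extends_from_m m (range d) ->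
  extends_from_m m [set x | d x = 0].
Proof.
move=> Eext dext phi phiL phid; have [s s0 ms] := socle_neq0.
have [|x _ xE] := Eext phi phiL; first by [].
have [||w [v _ <-] vE] := socle_divide (C := Submodule (range_is_submodule d)) dext s0 ms
  (u := d x).
- by exists x.
- by move=> a ma; rewrite -linearZ -xE //; exact: phid.
exists (x - s *: v) => [|a ma]; first by rewrite /= linearB linearZ /= vE subrr.
by rewrite scalerBr scalerA ms // scale0r subr0 xE.
Qed.

Lemma self_extends_from_m :
  finite_injective_dimension R^o -> extends_from_m m [set: R^o].
Proof.
move=> [n [E [eta [d [injE E0 etainj ex0 exd]]]]].
(* Descending induction along the injective resolution. For j >= n the target of d_j is zero and the
   kernel is all of E_j; below that, the image of d_j is the kernel of d_(j+1). *)
have ker_ext t : forall j, (n <= j + t)%N -> extends_from_m m [set x | d j x = 0].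
  elim: t => [|t IH] j jt.
    move=> phi phiL _.
    have [//|x _ xE] := injective_extends_from_m locR (injE j) phiL.
    by exists x => //=; apply: E0; rewrite -(addn0 j) ltnS.
  apply: extends_from_m_ker; first exact/injective_extends_from_m/injE.
  rewrite (_ : range _ = [set x | d j.+1 x = 0]); first by apply: IH; rewrite addSnnS.
  by apply/seteqP; split=> x /(exd j).
move=> phi phiL _; have [|a ma|y etay yE] := ker_ext n 0%N (leq_addl _ _) (eta \o phi).
- by move=> a x y mx my /=; rewrite phiL // linearP.
- by apply/ex0; exists (phi a).
have /ex0[r _ ry] : d 0%N y = 0 by [].
by exists r => // a ma; apply: etainj; rewrite -[LHS]/((eta \o phi) a) yE // linearZ ry.
Qed.

(** If x_0 = a g and x_1 = b g are two basis elements, the relation b x_0 - a x_1 = 0 puts a in m.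
    Then x_0 lies in [B], against independence. *)
Lemma residue_basis_cyclic (M : lmodType R) (A B : set M) d (x : 'I_d -> M) g :
    residue_basis m A B x -> (forall a, in_m a -> B (a *: g)) ->
    (forall y, A y -> exists c, y = c *: g) ->
  (d <= 1)%N.
Proof.
case: d x => [|[|d]] // x [Ax _ xindep] mgB Acyc.
have B0 : B 0 by rewrite -(scale0r g); exact/mgB/(sub_mem0 m).
have [a aE] := Acyc _ (Ax ord0); have [b bE] := Acyc _ (Ax (lift ord0 ord0)).
have ma : in_m (- a).
  have := xindep (fun i => if i == ord0 then b else if i == lift ord0 ord0 then - a else 0).
  rewrite big_ord_recl big_ord_recl /= big1 => [|i _]; last by rewrite scale0r.
  rewrite aE bE !scalerA addr0 -scalerDl mulNr [b * a]mulrC subrr scale0r.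
  by move=> /(_ B0 (lift ord0 ord0)).
case: (one_notin locR); have := xindep (fun i => (i == ord0)%:R) _ ord0; apply.
rewrite big_ord_recl /= big1 => [|i _]; last by rewrite scale0r.
rewrite scale1r addr0 aE; apply: mgB.
by rewrite -[a]opprK; exact: (sub_memN (N := m)).
Qed.

End Short.
End Gorenstein.

(** All that the rest of the argument uses about the ring: [s] generates both the simple socle and
    m^2, and R is self-injective in Baer's form. *)
Record short_gorenstein (R : comNzRingType) (m : ideal R) (s : R) : Prop := {
  sg_local : local_ring m;
  sg_cube : mpow m 3 R^o = [set 0];
  sg_ann : forall a, a * s = 0 <-> submodule_set m a;
  sg_socle : forall u, (forall a, submodule_set m a -> a * u = 0) ->
    exists c, u = c * s;
  sg_square : forall a, mpow m 2 R^o a <-> exists c, a = c * s;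
  sg_self : extends_from_m m [set: R^o]
}.

(** By self-injectivity any nonzero socle element generates the socle. The bound e >= 2 gives m^2 !=
    0: otherwise m would lie in the socle, hence be cyclic. So a nonzero product of two elements of
    m can serve as [s]. *)
Lemma gorenstein_short (R : comNzRingType) (m : ideal R) :
    gorenstein_local_ring m -> mpow m 3 R^o = [set 0] ->
    (2 <= krank m (submodule_set m) (mpow m 2 R^o))%N ->
  exists s, short_gorenstein m s.
Proof.
move=> [locR /(self_extends_from_m locR) ext] m3 e_ge2.
have {}ext := ext m3.
have soc (s : R) : s != 0 -> (forall a : R, submodule_set m a -> a * s = 0) ->
    forall u : R, (forall a : R, submodule_set m a -> a * u = 0) -> exists c : R, u = c * s.
  move=> s0 ms u mu.
  have [//|a /mu //|w _ <-] := socle_divide locR m3 (C := Submodule (module_setT R^o)) ext s0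
    ms (u := u).
  by exists w; rewrite mulrC.
have [a [b [ma mb ab0]]] : exists a b : R,
    [/\ submodule_set m a, submodule_set m b & a * b != 0].
  apply: contrapT => nab; move: e_ge2; rewrite /krank; case: xgetP => // d _ [x xb].
  have [s s0 ms] := socle_neq0 m3.
  have m_ms c : submodule_set m c -> exists d, c = d * s.
    move=> mc; apply: soc => // a ma; apply/eqP/negPn/negP => ac.
    by apply: nab; exists a, c.
  rewrite ltnNge (residue_basis_cyclic locR xb (g := s : R^o)) // => c mc.
  rewrite -[_ *: _]/(c * s) ms //; exact: mpow_mem0.
have abs : forall c, submodule_set m c -> c * (a * b) = 0.
  by move=> c mc; exact: (mul3_eq0 m3).
exists (a * b); split=> //.
- exact: socle_annihilator.
- exact: soc.
move=> c; split=> [mc|[d ->]].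
  apply: soc => // x mx.
  suff : mpow m 3 R^o (x * c) by rewrite m3.
  exact: (mpowS (M := R^o)).
apply: (mpow_memZ (M := R^o)); apply: (mpowS (M := R^o)) => //; exact/mpow1_ring.
Qed.

(** * Syzygies, retracts and duality *)

Section Syzygies.
Variables (R : comNzRingType) (m : ideal R) (s : R).
Local Notation in_m := (submodule_set m).
Hypothesis sgR : short_gorenstein m s.
Let locR := sg_local sgR.
Let m3 := sg_cube sgR.
Implicit Types M N L K : lmodType R.

Lemma row_square p (v : 'rV[R]_p) : mpow m 2 _ v <-> exists w, v = s *: w.
Proof.
split=> [/mpow_row vj|[w ->]]; last first.
  by apply/mpow_row => j; rewrite mxE; apply/(sg_square sgR); exists (w 0 j); rewrite mulrC.
have /choice[w wE] : forall j, exists c, v 0 j = c * s.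
  by move=> j; exact/(sg_square sgR).
by exists (\row_j w j); apply/rowP => j; rewrite !mxE wE mulrC.
Qed.

Lemma row_m p (v : 'rV[R]_p) : mpow m 1 _ v <-> s *: v = 0.
Proof.
split=> [/mpow_row vm|sv].
  by apply/rowP => j; rewrite !mxE mulrC; apply/(sg_ann sgR)/mpow1_ring.
apply/mpow_row => j; apply/mpow1_ring/(sg_ann sgR).
by have /rowP/(_ j) := sv; rewrite !mxE mulrC.
Qed.

Lemma row_socle p (v : 'rV[R]_p) :
  mpow m 2 _ v <-> forall a, in_m a -> a *: v = 0.
Proof.
split=> [/row_square[w ->] a /(sg_ann sgR) as0|mv].
  by rewrite scalerA as0 scale0r.
apply/mpow_row => j; apply/(sg_square sgR)/(sg_socle sgR) => a ma.
by have /rowP/(_ j) := mv a ma; rewrite !mxE.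
Qed.

Lemma free_injective p q L (i : {linear L -> 'rV[R]_p}) (h : {linear L -> 'rV[R]_q}) :
  injective i -> exists H : {linear 'rV[R]_p -> 'rV[R]_q}, forall x, H (i x) = h x.
Proof.
move=> iinj.
have /choice[H HE] : forall j : 'I_q, exists H : {linear 'rV[R]_p -> R^o},
    forall x, H (i x) = h x 0 j.
  move=> j; have [a x y|hj hjE] := @linear_build R L R^o (fun x => h x 0 j).
    by rewrite linearP !mxE.
  have [//|H [HE _]] := extends_from_m_inj locR m3
    (C := Submodule (module_setT R^o)) (sg_self sgR) (h := hj) (finite_free R p) iinj.
  by exists H => x; rewrite HE hjE.
have [a x y|G GE] := @linear_build R 'rV[R]_p 'rV[R]_q (fun v => \row_j H j v).
  by apply/rowP => j; rewrite !mxE linearP.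
by exists G => x; apply/rowP => j; rewrite GE mxE HE.
Qed.

Lemma retract_unipotent M N (f : {linear M -> N}) (g : {linear N -> M}) :
    (forall x, let d y := g (f y) - y in d (d (d x)) = 0) ->
  retract M N.
Proof.
move=> gf3; have [w wE] := @unipotent_retract R M (g \o f) gf3.
by exists f, (w \o g).
Qed.

Lemma raise_cube p (nu : {linear 'rV[R]_p -> 'rV[R]_p}) :
  (forall v, mpow m 1 _ (nu v)) -> forall v, nu (nu (nu v)) = 0.
Proof.
move=> num v; apply: (mpow_ge3_eq0 m3 (n := 3)) => //.
by do 2!rewrite -addn1; do 2!apply: (mpow_raise num); exact: num.
Qed.

(** A minimal cover of [M] with kernel [L], as a relation: both the cokernels in a resolution and
    the duals of syzygies satisfy it. *)
Definition syzygy_of p M L : Prop :=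
  exists (pi : {linear 'rV[R]_p -> M}) (iota : {linear L -> 'rV[R]_p}),
    [/\ forall x, exists v, pi v = x, injective iota,
        forall v, pi v = 0 <-> exists y, iota y = v &
        forall y, mpow m 1 _ (iota y)].

(** The lifts compose to 1 + nu on the cover of [N], where nu has values in the kernel of the cover,
    hence in mF. So nu^3 = 0 and the induced map on [K] is unipotent. *)
Lemma syzygy_retract p q M L N K :
  syzygy_of p N K -> syzygy_of q M L -> retract N M -> retract K L.
Proof.
move=> [pN [iN [pNs iNi exN mN]]] [pM [iM [pMs iMi exM mM]]] [f [g gf]].
have [Phi PhiE] := free_lift (f \o pN) pMs.
have [Psi PsiE] := free_lift (g \o pM) pNs.
have [y|f' f'E] := factor_inj (h := Phi \o iN) iMi.
  by apply/exM; rewrite /= PhiE /= (exN _).2 ?linear0 //; exists y.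
have [y|g' g'E] := factor_inj (h := Psi \o iM) iNi.
  by apply/exN; rewrite /= PsiE /= (exM _).2 ?linear0 //; exists y.
have [a x y|nu nuE] := @linear_build R 'rV[R]_p 'rV[R]_p (fun v => Psi (Phi v) - v).
  by rewrite (linearP Phi) (linearP Psi) scalerBr opprD addrACA.
have num v : mpow m 1 _ (nu v).
  have /exN[y <-] : pN (nu v) = 0 by rewrite nuE linearB PsiE /= PhiE /= gf subrr.
  exact: mN.
apply: (@retract_unipotent K L f' g') => x d.
have iNd y : iN (d y) = nu (iN y).
  by rewrite /d linearB g'E /= f'E nuE.
by apply: iNi; rewrite !iNd raise_cube // linear0.
Qed.

(** Here nu vanishes on [K]. Since m^2 N = 0, sF = m^2 F is contained in [K], so s nu = 0; the
    annihilator of s in F is mF, whence nu^3 = 0 again. *)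
Lemma cosyzygy_retract p q M L N K :
    (forall x, mpow m 2 N x -> x = 0) ->
  syzygy_of p N K -> syzygy_of q M L -> retract K L -> retract N M.
Proof.
move=> N2 [pN [iN [pNs iNi exN mN]]] [pM [iM [pMs iMi exM mM]]] [f [g gf]].
have [Phi PhiE] := free_injective (iM \o f) iNi.
have [Psi PsiE] := free_injective (iN \o g) iMi.
have [v /exN[y <-]|f' f'E] := factor_surj (h := pM \o Phi) pNs.
  by apply/exM; exists (f y); rewrite PhiE.
have [v /exM[y <-]|g' g'E] := factor_surj (h := pN \o Psi) pMs.
  by apply/exN; exists (g y); rewrite PsiE.
have [a x y|nu nuE] := @linear_build R 'rV[R]_p 'rV[R]_p (fun v => Psi (Phi v) - v).
  by rewrite (linearP Phi) (linearP Psi) scalerBr opprD addrACA.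
have num v : mpow m 1 _ (nu v).
  apply/row_m; rewrite -linearZ.
  have /exN[y yE] : pN (s *: v) = 0.
    by apply: N2; apply: mpow_linear; apply/row_square; exists v.
  by rewrite [_ *: v](esym yE) nuE PhiE /= PsiE /= gf subrr.
apply: (@retract_unipotent N M f' g') => x d.
have dp v : d (pN v) = pN (nu v).
  by rewrite /d f'E /= g'E /= nuE linearB.
by have [v <-] := pNs x; rewrite !dp raise_cube // linear0.
Qed.

Lemma syzygy_square p M L : syzygy_of p M L -> forall y, mpow m 2 L y -> y = 0.
Proof.
move=> [pi [iota [_ iinj _ im]]] y my; apply: iinj; rewrite linear0.
by apply: (mpow_ge3_eq0 m3 (n := 2 + 1)) => //; exact: mpow_raise my.
Qed.

(** Hom(-,R) is applied to 0 -> L -> R^p -> M -> 0, with R^p identified with its dual by the dot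
    product; self-injectivity gives surjectivity onto the dual of [L]. *)
Lemma dual_syzygy p M L : (forall x, mpow m 2 M x -> x = 0) ->
  syzygy_of p M L -> syzygy_of p (Defs.hom L R^o) (Defs.hom M R^o).
Proof.
move=> M2 [pi [iota [pis iinj ex im]]].
have /choice[pair pairE] : forall v : 'rV[R]_p, exists f : Defs.hom L R^o,
    forall y, (f : {linear L -> R^o}) y = \sum_j v 0 j * iota y 0 j.
  move=> v; apply: linear_build => a x y; rewrite scaler_sumr -big_split /=.
  by apply: eq_bigr => j _; rewrite linearP !mxE mulrDr mulrCA.
have [a v w|dpi dpiE] := @linear_build R 'rV[R]_p (Defs.hom L R^o) pair.
  apply: hom_ext => y; rewrite pairE.
  rewrite [RHS](_ : _ = a * (\sum_j v 0 j * iota y 0 j) + \sum_j w 0 j * iota y 0 j).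
    by rewrite mulr_sumr -big_split; apply: eq_bigr => j _; rewrite !mxE mulrDl mulrA.
  by rewrite -!pairE.
have [a f g|di diE] := @linear_build R (Defs.hom M R^o) 'rV[R]_p
    (fun f => \row_j (f : {linear M -> R^o}) (pi (delta_mx 0 j))).
  by apply/rowP => j; rewrite !mxE.
have dpi_pi (f : Defs.hom M R^o) v : (f : {linear M -> R^o}) (pi v) = \sum_j di f 0 j * v 0 j.
  rewrite [v in LHS]row_sum_delta !linear_sum; apply: eq_bigr => j _.
  by rewrite !linearZ diE mxE mulrC.
exists dpi, di; split.
- move=> f; have [a x y|h hE] := @linear_build R L 'rV[R]_1
      (fun y => \row_j (f : {linear L -> R^o}) y).
    by apply/rowP => j; rewrite !mxE linearP.
  have [H HE] := free_injective h iinj; exists (\row_j H (delta_mx 0 j) 0 0).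
  rewrite dpiE; apply: hom_ext => y; rewrite pairE.
  have -> : (f : {linear L -> R^o}) y = h y 0 0 by rewrite hE mxE.
  rewrite -HE [X in H X]row_sum_delta linear_sum summxE; apply: eq_bigr => j _.
  by rewrite linearZ !mxE mulrC.
- apply: linear_inj => f df; apply: hom_ext => x; have [v <-] := pis x.
  by rewrite dpi_pi df big1 // => j _; rewrite mxE mul0r.
- move=> v; rewrite dpiE; split=> [v0|[f <-]]; last first.
    apply: hom_ext => y; rewrite pairE -dpi_pi (ex _).2 ?linear0 //.
    by exists y.
  have [f fE] := free_map (fun j => v 0 j : R^o).
  have [w /ex[y <-]|g gE] := factor_surj (h := f) pis.
    have p0 : \sum_j v 0 j * iota y 0 j = 0 by rewrite -pairE v0.
    by rewrite fE -[RHS]p0; apply: eq_bigr => j _; exact: mulrC.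
  exists g; apply/rowP => j; rewrite diE mxE gE fE (bigD1 j) //= !mxE !eqxx.
  rewrite scale1r big1 ?addr0 // => k /negPf kj.
  by rewrite mxE kj andbF scale0r.
(* Minimality of the dual cover: s times a generator of [M] lies in m^2 M = 0, so its value under
   [f] is killed by s and hence lies in m. *)
- move=> f; apply/mpow_row => j; apply/mpow1_ring/(sg_ann sgR).
  have : mpow m 2 M (s *: pi (delta_mx 0 j)).
    by rewrite -linearZ; apply: mpow_linear; apply/row_square; exists (delta_mx 0 j).
  move/M2/(congr1 (f : {linear M -> R^o})); rewrite linearZ linear0.
  by rewrite diE mxE mulrC.
Qed.

End Syzygies.

(** * Minimal free resolutions *)

Section Resolutions.
Variables (R : comNzRingType) (m : ideal R) (s : R).
Local Notation in_m := (submodule_set m).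
Local Notation k := (residue_field m).
Hypothesis sgR : short_gorenstein m s.
Let locR := sg_local sgR.
Let m3 := sg_cube sgR.
Implicit Types M N L K : lmodType R.

(** The covers are left existential, so chains from resolutions and from their duals are treated
    alike. *)
Fixpoint syzygy_chain n M K : Prop :=
  if n is n'.+1 then
    exists p M', syzygy_of m p M M' /\ syzygy_chain n' M' K
  else M = K.

Lemma syzygy_chain_rcons n p M L K :
  syzygy_chain n M L -> syzygy_of m p L K -> syzygy_chain n.+1 M K.
Proof.
elim: n M => [|n IH] M; first by move=> -> LK; exists p, K.
by move=> [q [M' [MM' M'L]]] LK; exists q, M'; split=> //; exact: IH.
Qed.

Lemma syzygy_chain_retract n M L N K :
  syzygy_chain n N K -> syzygy_chain n M L -> retract N M -> retract K L.
Proof.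
elim: n M N => [|n IH] M N; first by move=> /= -> ->.
move=> [p [N' [NN' N'K]]] [q [M' [MM' M'L]]] NM.
exact: IH N'K M'L (syzygy_retract sgR NN' MM' NM).
Qed.

Lemma syzygy_chain_coretract n M L N K : (forall x, mpow m 2 N x -> x = 0) ->
  syzygy_chain n N K -> syzygy_chain n M L -> retract K L -> retract N M.
Proof.
elim: n M N => [|n IH] M N N2; first by move=> /= -> ->.
move=> [p [N' [NN' N'K]]] [q [M' [MM' M'L]]] KL.
apply: (cosyzygy_retract sgR N2 NN' MM'); apply: IH N'K M'L KL.
exact: (syzygy_square sgR NN').
Qed.

(** Duality reverses the chain, so the dual of the first step is appended at the end. *)
Lemma dual_syzygy_chain n M K : (forall x, mpow m 2 M x -> x = 0) ->
  syzygy_chain n M K -> syzygy_chain n (Defs.hom K R^o) (Defs.hom M R^o).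
Proof.
elim: n M => [|n IH] M M2; first by move=> /= ->.
move=> [p [M' [MM' M'K]]]; have M'2 := syzygy_square sgR MM'.
exact: syzygy_chain_rcons (IH _ M'2 M'K) (dual_syzygy sgR M2 MM').
Qed.

(** Syzygies are defined as cokernels; exactness turns them into submodules of the next free
    module. *)
Lemma coker_embed (A B C : lmodType R) (f : {linear A -> B}) (g : {linear B -> C}) :
    exact_at f g ->
  exists (p : {linear B -> coker f}) (i : {linear coker f -> C}),
    [/\ forall y, exists x, p x = y, forall x, p x = 0 <-> range f x,
        injective i & forall x, i (p x) = g x].
Proof.
move=> ex; have [p [psurj pker]] := quotient_map (Submodule (range_is_submodule f)).
have [x /pker/ex//|i ip] := factor_surj (h := g) psurj.
exists p, i; split=> //; apply: linear_inj => y; have [x <-] := psurj y.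
by rewrite ip => /ex/pker.
Qed.

Lemma resolution_syzygy0 M (F : minimal_free_resolution m M) :
  syzygy_of m (betti F 0) M (syzygy F 1).
Proof.
have [p [i [psurj pker iinj ip]]] := coker_embed (@exact_diff _ _ _ F 0).
exists (aug F), i; split=> // [x|v|y].
- have : [set: M] x by []; rewrite -(aug_surj F) => -[v _ <-]; by exists v.
- split=> [/exact_aug[x _ <-]|[y <-]]; first by exists (p x).
  by have [x <-] := psurj y; apply/exact_aug; rewrite ip; exists x.
- by have [x <-] := psurj y; rewrite ip; exact: diff_minimal.
Qed.

Lemma resolution_syzygyS M (F : minimal_free_resolution m M) n :
  syzygy_of m (betti F n.+1) (syzygy F n.+1) (syzygy F n.+2).
Proof.
have [p [i [psurj pker iinj ip]]] := coker_embed (@exact_diff _ _ _ F n.+1).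
have [q [j [qsurj qker _ _]]] := coker_embed (@exact_diff _ _ _ F n).
exists q, i; split=> // [v|y].
- split=> [/qker[x _ <-]|[y <-]]; first by exists (p x).
  by have [x <-] := psurj y; apply/qker; rewrite ip; exists x.
- by have [x <-] := psurj y; rewrite ip; exact: diff_minimal.
Qed.

Lemma resolution_chain M (F : minimal_free_resolution m M) n :
  syzygy_chain n.+1 M (syzygy F n.+1).
Proof.
elim: n => [|n IH].
  by exists (betti F 0), (syzygy F 1); split=> //; exact: resolution_syzygy0.
exact: syzygy_chain_rcons IH (resolution_syzygyS F n).
Qed.

Definition socle_in_radical M : Prop :=
  forall y : M, (forall a, in_m a -> a *: y = 0) -> mpow m 1 M y.

Lemma residue_field_map : exists p : {linear R^o -> k},
  [/\ forall y, exists x, p x = y, forall x, p x = 0 <-> in_m x &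
      forall a, p a = a *: p 1].
Proof.
have [p [psurj pker]] := quotient_map m; exists p; split=> // a.
by rewrite -linearZ -[_ *: 1]/(a * 1) mulr1.
Qed.

Lemma residue_field_radical (x : k) : mpow m 1 k x -> x = 0.
Proof.
have [p [psurj pker _]] := residue_field_map.
by move=> /(mpow_surj psurj)[a /mpow1_ring/pker a0 <-].
Qed.

Lemma residue_field_square (x : k) : mpow m 2 k x -> x = 0.
Proof. by move=> /mpow_dec/residue_field_radical. Qed.

(** A socle element y outside mM spans a copy of k. A lift v of y to the cover has a unit coordinate
    v_j, and with c v_j = 1 the class of c x_j defines a projection to k; it factors through [M]
    because the kernel of the cover lies in mF. *)
Lemma socle_in_radicalPn p M L :
  syzygy_of m p M L -> ~ socle_in_radical M <-> retract k M.
Proof.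
move=> [pi [iota [pis iinj ex im]]].
have [q [qsurj qker q1]] := residue_field_map.
split=> [/existsNP[y /not_implyP[my nmy]]|[f [g gf]] sM]; last first.
  apply: (one_notin locR); apply/qker; rewrite -(gf (q 1)); apply: residue_field_radical.
  apply: mpow_linear; apply: sM => a ma.
  by rewrite -linearZ -q1 (qker a).2 ?linear0.
have [v vE] := pis y.
have [j vj] : exists j, ~ in_m (v 0 j).
  apply: contrapT => vm; apply: nmy; rewrite -vE; apply: mpow_linear.
  by apply/mpow_row => j; apply/mpow1_ring; apply: contrapT => vj; apply: vm; exists j.
have [c cv] := notin_unit locR m3 vj.
have [a x z|f0 f0E] := @linear_build R R^o M (fun a => a *: y).
  by rewrite scalerDl -scalerA.
have [x /qker xm|f fE] := factor_surj (h := f0) qsurj; first by rewrite f0E my.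
have [a x z|h hE] := @linear_build R 'rV[R]_p k (fun x => q (c * x 0 j)).
  by rewrite !mxE mulrDr mulrCA; exact: (linearP q a (c * _)).
have [x /ex[z <-]|g gE] := factor_surj (h := h) pis.
  rewrite hE; apply/qker; apply: (sub_memZ (N := m)); apply/mpow1_ring.
  by move: j {vj cv hE}; apply/mpow_row.
exists f, g => x; have [a <-] := qsurj x.
by rewrite fE f0E -vE -linearZ gE hE mxE mulrCA cv mulr1.
Qed.

(** A map k -> R sends 1 into the socle Rs, so it is a multiple of the map [t] sending 1 to s. *)
Lemma residue_field_dual :
  retract k (Defs.hom k R^o) /\ retract (Defs.hom k R^o) k.
Proof.
have [q [qsurj qker q1]] := residue_field_map.
have [a x z|s0 s0E] := @linear_build R R^o R^o (fun a => a * s).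
  by rewrite mulrDl -[_ *: _]/(_ * _) -mulrA.
have [x /qker xm|t tE] := factor_surj (h := s0) qsurj.
  by rewrite s0E; apply/(sg_ann sgR).
have tinj : injective t.
  apply: linear_inj => y; have [x <-] := qsurj y.
  by rewrite tE s0E => /(sg_ann sgR)/qker.
have [a f g|ev evE] := @linear_build R (Defs.hom k R^o) R^o
  (fun f => (f : {linear k -> R^o}) (q 1)); first by [].
have [f|g gE] := factor_inj (h := ev) tinj.
  have [a ma|c cE] := sg_socle sgR (u := ev f); last by exists (q c); rewrite tE s0E cE.
  rewrite evE -[_ * _]/(a *: (f : {linear k -> R^o}) (q 1)).
  by rewrite -linearZ -q1 (qker a).2 ?linear0.
pose t' : Defs.hom k R^o := t.
have [a x z|h0 h0E] := @linear_build R R^o (Defs.hom k R^o) (fun b : R => b *: t').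
  by rewrite scalerDl -scalerA.
have [x /qker mx|h hE] := factor_surj (h := h0) qsurj.
  rewrite h0E; apply: hom_ext => y; have [b <-] := qsurj y.
  rewrite -[LHS]/(x *: t (q b)).
  have xs : (x : R) * s = 0 by apply/(sg_ann sgR).
  have -> : t (q b) = (b : R) * s by rewrite tE s0E.
  by rewrite -[LHS]/((x : R) * ((b : R) * s)) mulrCA xs mulr0.
have hgx b y : (h (q b) : {linear k -> R^o}) y = b * t y by rewrite hE h0E.
split; [exists h, g|exists g, h] => [x|f].
  by have [b <-] := qsurj x; apply: tinj; rewrite gE evE hgx !tE !s0E mul1r.
apply: hom_ext => y; have [a <-] := qsurj y.
have [b bE] := qsurj (g f).
rewrite -bE hgx q1 !linearZ mulrCA -[_ * t _]/(b * t (q 1)).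
by rewrite tE s0E mul1r -s0E -tE bE gE evE.
Qed.

End Resolutions.

(** * Linear strands *)

Section Koszul.
Variables (R : comNzRingType) (m : ideal R) (s : R).
Local Notation in_m := (submodule_set m).
Hypothesis sgR : short_gorenstein m s.
Let m3 := sg_cube sgR.
Variables (M : lmodType R) (F : minimal_free_resolution m M).

Lemma socle_syzygyP n : socle_in_radical m (syzygy F n.+1) <->
  forall x, mpow m 2 _ (diff F n x) -> mpow m 1 _ x.
Proof.
have [p [i [psurj pker iinj ip]]] := coker_embed (@exact_diff _ _ _ F n).
have socP x : mpow m 2 _ (diff F n x) <-> forall a, in_m a -> a *: p x = 0.
  have iZ a : a *: i (p x) = i (a *: p x) by rewrite linearZ.
  rewrite -ip (row_socle sgR); split=> xP a /xP; rewrite iZ; last by move=> ->; rewrite linear0.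
  by rewrite -[RHS](linear0 i) => /iinj.
have radP x : mpow m 1 _ (p x) <-> mpow m 1 _ x.
  split=> [/(mpow_surj psurj)[z mz pzx]|]; last exact: mpow_linear.
  have /pker[y _ xzE] : p (x - z) = 0 by rewrite linearB pzx subrr.
  rewrite -(subrK z x); apply: mpow_memD => //; rewrite -xzE.
  exact: diff_minimal.
split=> [soc x /socP/soc/radP//|A y].
by have [x <-] := psurj y; move=> /socP/A/radP.
Qed.

Lemma koszulP : (forall j, lin_acyclic F j) <->
  forall n, socle_in_radical m (syzygy F n.+1).
Proof.
have z0 n (A : lmodType R) : mpow m n A 0 by exact: mpow_mem0.
have ge3 n (A : lmodType R) (x : A) : mpow m n.+3 A x -> x = 0.
  exact: (mpow_ge3_eq0 m3).
have augs x : exists v, aug F v = x.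
  by have : [set: M] x by []; rewrite -(aug_surj F) => -[v _ <-]; exists v.
split=> [ac n|soc j].
  (* For j = n+1 the strand has F_(n+1)/mF_(n+1) in degree n+1 and zero in degree n+2, so exactness
     there is injectivity. *)
  apply/socle_syzygyP => x mx; have [_ _ /(_ n x)] := ac n.+1.
  rewrite /lin_num /lin_den ltnn leqnn leqnSn !subnn subSnn (subSn (leqnSn n)) subSnn.
  by move=> /(_ I)[/(_ mx)[y -> ]]; rewrite linear0 subr0.
have A n := (socle_syzygyP n).1 (soc n).
have dmin n x i : mpow m i _ x -> mpow m i.+1 _ (diff F n x).
  by rewrite -[i.+1]addn1; apply: mpow_raise; exact: diff_minimal.
(* [z] turns the cycle [y] of the strand into the cycle [y - z] of [F]; after that,
   only [i = 2] requires [A]. *)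
have lin_exact n i (y z : 'rV_(betti F n)) : mpow m i _ y -> mpow m i.+1 _ z ->
    range (diff F n) (y - z) ->
  exists2 x, (if i is i'.+1 then mpow m i' _ x else x = 0) & mpow m i.+1 _ (y - diff F n x).
  case: i => [|[|[|i]]] my mz [x _ xE].
  - exists 0 => //; rewrite linear0 subr0 -(subrK z y) -xE.
    by apply: mpow_memD => //; exact: diff_minimal.
  - by exists x => //; rewrite xE opprB addrC subrK.
  - have x1 : mpow m 1 _ x by apply: A; rewrite xE; apply: mpow_memB => //; exact: mpow_dec.
    by exists x => //; rewrite xE opprB addrC subrK.
  - by exists 0 => //; rewrite linear0 subr0 (ge3 _ _ _ my).
have numE n i (x : 'rV_(betti F n.+1)) :
    (if i is i'.+1 then mpow m i' _ x else x = 0) <-> lin_num F (n + i) n.+1 x.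
  rewrite /lin_num (_ : (n < n + i)%N = (0 < i)%N); last by rewrite -ltn_subLR // subnn.
  by rewrite subnS addKn; case: i.
split=> [y my|y|n y].
- split=> // _; have [x mx <-] := mpow_surj augs my.
  by exists x; rewrite /lin_num ?subn0 // subrr.
- rewrite /lin_num /lin_den /= !subn0 => my; split=> [|[x xP mx]]; last first.
    have := mpow_linear (m := m) (n := j.+1) (aug F) mx; rewrite linearB.
    have /exact_aug -> : range (diff F 0) (diff F 0 x) by exists x.
    by rewrite subr0.
  move=> mauy; have [z mz yz] := mpow_surj (n := j.+1) augs mauy.
  have /exact_aug yz0 : aug F (y - z) = 0 by rewrite linearB yz subrr.
  by have [x /numE xP xE] := lin_exact _ _ _ _ my mz yz0; exists x.
have [nj|jn] := leqP n.+1 j; last first.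
  rewrite [lin_num F j n.+1]/lin_num leqNgt jn /= => ->; rewrite linear0; split=> _.
    exists 0; first by rewrite /lin_num; case: ifP.
    by rewrite linear0 subr0 /lin_den; case: ifP.
  by rewrite /lin_den; case: ifP.
rewrite -(subnKC nj); move: (j - n.+1)%N => i; rewrite /lin_den [lin_num F _ n.+1]/lin_num.
rewrite leq_addr addSn leqW ?leq_addr // -addnS subSn ?leq_addr // addKn.
have -> : (n + i.+1 - n.+1 = i)%N by rewrite subnS addKn.
rewrite subSS addKn addnS -addSn.
move=> my; split=> [mdy|[x _ mx]]; last first.
  have /exact_diff dd : range (diff F n.+1) (diff F n.+1 x) by exists x.
  by have := dmin _ _ _ mx; rewrite linearB dd subr0.
(* For i = 0 the socle condition puts y itself in mF, so z = y; for i > 0 the image of y lies in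
   m^(i+2) F = 0, so z = 0. *)
have [z mz zE] : exists2 z, mpow m i.+1 _ z & diff F n y = diff F n z.
  case: i mdy my => [/A my _|i /ge3 -> _]; first by exists y.
  by exists 0; rewrite ?linear0.
have /exact_diff yz0 : diff F n (y - z) = 0 by rewrite linearB zE subrr.
have [x /numE xP xE] := lin_exact _ _ _ _ my mz yz0; exists x => //.
Qed.

End Koszul.

(** * Existence of minimal resolutions *)

Section Existence.
Variables (R : comNzRingType) (m : ideal R).
Local Notation in_m := (submodule_set m).
Hypotheses (locR : local_ring m) (m3 : mpow m 3 R^o = [set 0]).

(** Induction on the rank: lift generators of the ideal of first coordinates, and add generators of
    the part of [K] whose first coordinate is zero. *)
Lemma noetherian_free p (K : submodule 'rV[R]_p) :
  exists n (X : 'M[R]_(n, p)), forall v, submodule_set K v <-> exists a, v = a *m X.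
Proof.
have [noethR _ _] := locR; elim: p K => [|p IH] K.
  exists 0%N, 0 => v; rewrite [v]thinmx0; split=> [_|_]; last exact: sub_mem0.
  by exists 0; rewrite mulmx0.
pose I := [set c : R^o | exists v : 'rV_p, submodule_set K (row_mx (c%:M : 'rV_1) v)].
have Isub : is_submodule I.
  split; first by exists 0; rewrite raddf0 row_mx0; exact: sub_mem0.
  move=> a c d [v Kv] [w Kw]; exists (a *: v + w).
  have -> : row_mx ((a *: c + d)%:M : 'rV_1) (a *: v + w) =
      a *: row_mx (c%:M : 'rV_1) v + row_mx (d%:M : 'rV_1) w.
    by rewrite scale_row_mx add_row_mx scale_scalar_mx raddfD.
  by apply: sub_memD => //; exact: sub_memZ.
have [n [c cE]] := noethR (Submodule Isub).
have /choice[v vE] : forall i, exists v : 'rV_p, submodule_set K (row_mx ((c i)%:M : 'rV_1) v).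
  move=> i; suff : I (c i) by [].
  rewrite [I]cE; exists (fun j => (j == i)%:R) => //.
  by rewrite (bigD1 i) //= eqxx scale1r big1 ?addr0 // => j /negPf ->; rewrite scale0r.
pose J := [set w : 'rV_p | submodule_set K (row_mx (0 : 'rV_1) w)].
have Jsub : is_submodule J.
  split; first by rewrite /J /= row_mx0; exact: sub_mem0.
  move=> a w z Kw Kz; rewrite /J /= -[0 : 'rV_1](addr0 0) -{1}(scaler0 _ a).
  rewrite -add_row_mx -scale_row_mx; apply: sub_memD => //; exact: sub_memZ.
have [n' [Y YE]] := IH (Submodule Jsub).
pose X1 : 'M_(n, 1 + p) := \matrix_i row_mx ((c i)%:M : 'rV_1) (v i).
have X1E (a : 'rV_n) :
    a *m X1 = row_mx ((\sum_i a 0 i * c i)%:M : 'rV_1) (\sum_i a 0 i *: v i).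
  rewrite mulmx_sum_row.
  under eq_bigr do rewrite rowK scale_row_mx scale_scalar_mx.
  by elim/big_rec3: _ => [|i x y z _ ->]; rewrite ?raddf0 ?row_mx0 // add_row_mx raddfD.
have KX1 a : submodule_set K (a *m X1).
  rewrite mulmx_sum_row; apply: (big_ind (submodule_set K)) => [|x y|i _].
  - exact: sub_mem0.
  - exact: sub_memD.
  - by rewrite rowK; exact: sub_memZ.
pose X2 : 'M_(n', 1 + p) := row_mx 0 Y.
have X2E (b : 'rV_n') : b *m X2 = row_mx (0 : 'rV_1) (b *m Y).
  by rewrite mul_mx_row mulmx0.
exists (n + n')%N, (col_mx X1 X2).
suff gen (w : 'rV_(1 + p)) :
  submodule_set K w <-> exists a : 'rV_(n + n'), w = a *m col_mx X1 X2 by exact: gen.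
split=> [Kw|[a ->]]; last first.
  rewrite -[a]hsubmxK mul_row_col; apply: sub_memD => //.
  by rewrite X2E; apply/YE; exists (rsubmx a).
have [a aE] : exists a : 'rV_n, lsubmx w = (\sum_i a 0 i * c i)%:M.
  have : I (lsubmx w 0 0) by exists (rsubmx w); rewrite -mx11_scalar hsubmxK.
  rewrite [I]cE => -[a _ aE]; exists (\row_i a i).
  rewrite [LHS]mx11_scalar -aE; congr (_%:M); apply: eq_bigr => i _.
  by rewrite mxE.
have /YE[b bE] : J (rsubmx w - \sum_i a 0 i *: v i).
  rewrite /J /=; have -> : row_mx (0 : 'rV_1) (rsubmx w - \sum_i a 0 i *: v i) = w - a *m X1.
    by rewrite X1E -aE -{2}[w]hsubmxK opp_row_mx add_row_mx subrr.
  by apply: sub_memD => //; exact: sub_memN.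
exists (row_mx a b); rewrite mul_row_col X2E -bE X1E -aE add_row_mx.
by rewrite addr0 addrC subrK hsubmxK.
Qed.

(** In a generating family of least size, a relation with a unit coefficient would eliminate a
    generator. *)
Lemma minimal_generators (V : lmodType R) (K : set V) : fin_gen K ->
  exists n (x : 'I_n -> V), K = range (fun a : 'I_n -> R => \sum_i a i *: x i) /\
    forall a : 'I_n -> R, \sum_i a i *: x i = 0 -> forall i, in_m (a i).
Proof.
move=> Kfg; pose P n := `[< exists x : 'I_n -> V,
  K = range (fun a : 'I_n -> R => \sum_i a i *: x i) >].
have exP : exists n, P n by have [n [x xE]] := Kfg; exists n; apply/asboolP; exists x.
case: (ex_minnP exP) => n /asboolP[x xE] nmin; exists n, x; split=> // a ax0 j.
apply: contrapT => /(notin_unit locR m3)[c ca].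
case: n x xE nmin a ax0 j ca => [|n] x xE nmin a ax0 j ca; first by case: j ca.
suff /nmin : P n by rewrite ltnn.
apply/asboolP; exists (x \o lift j); rewrite xE; apply/seteqP; split=> _ [b _ <-].
  exists (fun i => b (lift j i) - b j * c * a (lift j i)) => //.
  have bca0 : (b j * c) *: (\sum_i a i *: x i) = 0 by rewrite ax0 scaler0.
  rewrite (bigD1_ord j) //= -[RHS]subr0 -[X in _ - X]bca0 (bigD1_ord j) //=.
  rewrite scalerDr scalerA -mulrA ca mulr1 opprD addrACA subrr add0r.
  rewrite scaler_sumr -sumrB; apply: eq_bigr => i _.
  by rewrite scalerBl !scalerA.
exists (fun i => if unlift j i is Some i' then b i' else 0) => //.
rewrite (bigD1_ord j) //= unlift_none scale0r add0r.
by apply: eq_bigr => i _; rewrite liftK.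
Qed.

Lemma minimal_cover (V : lmodType R) (K : set V) : fin_gen K ->
  exists q (f : {linear 'rV[R]_q -> V}), range f = K /\ forall x, f x = 0 -> mpow m 1 _ x.
Proof.
move=> /minimal_generators[q [x [-> xm]]]; have [f fE] := free_map x.
exists q, f; split=> [|v]; last first.
  by rewrite fE => /xm vm; apply/mpow_row => j; apply/mpow1_ring.
apply/seteqP; split=> [_ [v _ <-]|_ [a _ <-]]; first by exists (v 0); rewrite ?fE.
by exists (\row_i a i); rewrite ?fE //; apply: eq_bigr => i _; rewrite mxE.
Qed.

Lemma fin_gen_image p (V : lmodType R) (f : {linear 'rV[R]_p -> V})
    (K : submodule 'rV[R]_p) :
  fin_gen (f @` submodule_set K).
Proof.
have [n [X XE]] := noetherian_free K; exists n, (fun i => f (row i X)).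
apply/seteqP; split=> [_ [v /XE[a ->] <-]|_ [a _ <-]].
  exists (a 0) => //; rewrite mulmx_sum_row linear_sum.
  by apply: eq_bigr => i _; rewrite linearZ.
exists (\sum_i a i *: row i X).
  apply/XE; exists (\row_i a i); rewrite mulmx_sum_row.
  by apply: eq_bigr => i _; rewrite mxE.
by rewrite linear_sum; apply: eq_bigr => i _; rewrite linearZ.
Qed.

(** Minimal generators of m^n M work: a combination lying in m^(n+1) M can be rewritten with
    coefficients in m, and the difference is a relation. *)
Lemma mpow_basis n (M : lmodType R) : finite_module M ->
  exists d (x : 'I_d -> M), residue_basis m (mpow m n M) (mpow m n.+1 M) x.
Proof.
move=> /minimal_cover[q [f [fE _]]].
have fs y : exists v, f v = y by have : [set: M] y by []; rewrite -fE => -[v _ <-]; exists v.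
have : fin_gen (mpow m n M).
  have -> : mpow m n M = f @` mpow m n 'rV[R]_q.
    apply/seteqP; split=> [y /(mpow_surj fs)[v mv <-]|_ [v mv <-]]; first by exists v.
    exact: mpow_linear.
  exact: (@fin_gen_image q M f (mpow_module m n _)).
move=> /minimal_generators[d [x [xE xm]]]; exists d, x; split=> [i|y|a].
- rewrite xE; exists (fun j => (j == i)%:R) => //.
  by rewrite (bigD1 i) //= eqxx scale1r big1 ?addr0 // => j /negPf ->; rewrite scale0r.
- by rewrite xE => -[a _ <-]; exists a; rewrite subrr; exact: mpow_mem0.
move=> ax i; have : exists2 b : 'I_d -> R, (forall i, in_m (b i)) &
    \sum_i a i *: x i = \sum_i b i *: x i.
  move: ax; move: (\sum_i a i *: x i); apply: mpow_ind.
  - exists (fun=> 0) => [?|]; first exact: sub_mem0.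
    by rewrite big1 // => j _; rewrite scale0r.
  - move=> _ _ [b mb ->] [c mc ->]; exists (fun j => b j + c j) => [j|].
      exact: sub_memD.
    by rewrite -big_split; apply: eq_bigr => j _; rewrite scalerDl.
  - move=> c y mc; rewrite xE => -[b _ <-]; exists (fun j => b j * c) => [j|].
      exact: (sub_memZ (N := m) (b j)).
    by rewrite scaler_sumr; apply: eq_bigr => j _; rewrite scalerA mulrC.
move=> [b mb abx]; rewrite -(subrK (b i) (a i)); apply: sub_memD => //.
apply: (xm (fun i => a i - b i)).
under eq_bigr do rewrite scalerBl.
by rewrite sumrB abx subrr.
Qed.

Lemma minimal_resolution_exists (M : lmodType R) : finite_module M ->
  inhabited (minimal_free_resolution m M).
Proof.
move=> /minimal_cover[q0 [f0 [f0E f0m]]].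
have kerP p (V : lmodType R) (f : {linear 'rV[R]_p -> V}) : is_submodule [set x | f x = 0].
  by split=> [|a x y /= fx fy]; rewrite /= ?linear0 // linearP fx fy scaler0 addr0.
(* A state is a free module with the kernel still to be covered; each step covers it minimally and
   passes to the new kernel. *)
pose state := {p : nat & submodule 'rV[R]_p}.
have step_ex (S : state) : {q : nat & {f : {linear 'rV[R]_q -> 'rV[R]_(projT1 S)} |
    range f = submodule_set (projT2 S) /\ forall x, f x = 0 -> mpow m 1 _ x}}.
  case: S => p K /=; have Kfg : fin_gen (submodule_set K).
    have := @fin_gen_image p _ idfun K; congr fin_gen.
    by apply/seteqP; split=> [_ [x Kx <-]//|x Kx]; exists x.
  by have /cid[q /cid[f fP]] := minimal_cover Kfg; exists q, f.
pose next (S : state) : state :=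
  existT _ (projT1 (step_ex S)) (Submodule (kerP _ _ (sval (projT2 (step_ex S))))).
pose st n : state := iter n next (existT _ q0 (Submodule (kerP _ _ f0))).
pose d n : {linear 'rV[R]_(projT1 (st n.+1)) -> 'rV[R]_(projT1 (st n))} :=
  sval (projT2 (step_ex (st n))).
have dE n : range (d n) = submodule_set (projT2 (st n)).
  by have [] := svalP (projT2 (step_ex (st n))).
have stm n x : submodule_set (projT2 (st n)) x -> mpow m 1 _ x.
  case: n x => [|n] x /=; first exact: f0m.
  by have [_] := svalP (projT2 (step_ex (st n))); apply.
constructor; apply: (@MinimalFreeResolution _ _ _ (fun n => projT1 (st n)) d f0) => //.
- by move=> y; rewrite dE.
- by move=> n y; rewrite dE.
- by move=> n x; apply: stm; rewrite -dE; exists x.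
Qed.

End Existence.

(** * Ranks *)

Section Ranks.
Variables (R : comNzRingType) (m : ideal R) (s : R).
Local Notation in_m := (submodule_set m).
Hypothesis sgR : short_gorenstein m s.
Let m3 := sg_cube sgR.
Implicit Types M N L K : lmodType R.

(** Arbitrary finite index types, since the counting below uses bases indexed by a product and by a
    sum. *)
Definition indexed_basis (T : finType) M (A B : set M) (x : T -> M) : Prop :=
  [/\ forall t, A (x t),
      forall y, A y -> exists a : T -> R, B (y - \sum_t a t *: x t) &
      forall a : T -> R, B (\sum_t a t *: x t) -> forall t, in_m (a t)].

Lemma indexed_residue_basis (T : finType) M (A B : set M) (x : T -> M) :
  indexed_basis A B x -> residue_basis m A B (fun i : 'I_#|T| => x (enum_val i)).
Proof.
have sumE (a : T -> R) :
    \sum_(i < #|T|) a (enum_val i) *: x (enum_val i) = \sum_t a t *: x t.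
  by rewrite -(big_enum_val (fun t => a t *: x t)); apply: eq_bigl.
move=> [Ax xgen xindep]; split=> [//|y /xgen[a aE]|a].
  by exists (a \o enum_val); rewrite sumE.
have -> : \sum_i a i *: x (enum_val i) =
    \sum_(i < #|T|) (a \o enum_rank) (enum_val i) *: x (enum_val i).
  by apply: eq_bigr => i _; rewrite /= enum_valK.
by rewrite sumE => /xindep ai i; have := ai (enum_val i); rewrite /= enum_valK.
Qed.

(** The transition matrices satisfy PQ = 1 + N with entries of N in m. As N^3 = 0, (1 - N + N^2)P is
    a left inverse of Q, which bounds the sizes directly over R. *)
Lemma residue_basis_leq M (A : set M) (B : submodule M)
    d (x : 'I_d -> M) d' (y : 'I_d' -> M) :
  residue_basis m A (submodule_set B) x -> residue_basis m A (submodule_set B) y ->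
  (d' <= d)%N.
Proof.
move=> [Ax xgen _] [Ay ygen yindep].
have /choice[P PE] := fun j => xgen _ (Ay j).
have /choice[Q QE] := fun i => ygen _ (Ax i).
pose Pm : 'M_(d', d) := \matrix_(j, i) P j i.
pose Qm : 'M_(d, d') := \matrix_(i, j) Q i j.
pose N := Pm *m Qm - 1%:M.
have Bsum (I : finType) (F : I -> M) : (forall i, submodule_set B (F i)) ->
    submodule_set B (\sum_i F i).
  move=> BF; apply: (big_ind (submodule_set B)) => // [|u v].
    exact: sub_mem0.
  exact: sub_memD.
have Nm j j' : in_m (N j j').
  apply: (yindep (N j)).
  have -> : \sum_j' N j j' *: y j' =
      - (\sum_i P j i *: (x i - \sum_j' Q i j' *: y j')) - (y j - \sum_i P j i *: x i).
    transitivity (\sum_i P j i *: (\sum_j' Q i j' *: y j') - y j).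
      have NE l : N j l = \sum_i P j i * Q i l - (j == l)%:R.
        by rewrite !mxE; under eq_bigr do rewrite !mxE.
      transitivity (\sum_l \sum_i (P j i * Q i l) *: y l - \sum_l (j == l)%:R *: y l).
        by rewrite -sumrB; apply: eq_bigr => l _; rewrite NE scalerBl scaler_suml.
      rewrite exchange_big /=; congr (_ - _).
        apply: eq_bigr => i _; rewrite scaler_sumr.
        by apply: eq_bigr => l _; rewrite scalerA.
      rewrite (bigD1 j) //= eqxx scale1r big1 ?addr0 // => l /negPf lj.
      by rewrite eq_sym lj scale0r.
    under [in RHS]eq_bigr do rewrite scalerBr.
    by rewrite sumrB !opprB addrA subrK.
  apply: sub_memD; apply: sub_memN => //.
  by apply: Bsum => i; exact: sub_memZ.
have N3 : N *m N *m N = 0.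
  apply/matrixP => i j; rewrite !mxE big1 // => l _; rewrite mxE mulr_suml big1 // => t _.
  by rewrite -mulrA (mul3_eq0 m3).
have PQ : Pm *m Qm = 1%:M + N by rewrite addrC subrK.
clearbody N; apply: (@mulmx1_min _ _ _ ((1%:M - N + N *m N) *m Pm) Qm).
rewrite -mulmxA PQ.
rewrite mulmxDr mulmx1 !mulmxDl mulNmx mul1mx N3 addr0.
by rewrite addrACA subrK subrr addr0.
Qed.

Lemma krank_unique M (A : set M) (B : submodule M) d (x : 'I_d -> M) :
  residue_basis m A (submodule_set B) x -> krank m A (submodule_set B) = d.
Proof.
move=> xb; rewrite /krank; case: xgetP => [d' _ [y yb]|/(_ d) []]; last by exists x.
apply/eqP; rewrite eqn_leq.
by rewrite (residue_basis_leq xb yb) (residue_basis_leq yb xb).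
Qed.

Lemma syzygy_top p M L : syzygy_of m p M L ->
  exists x : 'I_p -> M, residue_basis m (mpow m 0 M) (mpow m 1 M) x.
Proof.
move=> [pi [iota [pis _ ex im]]]; exists (fun j => pi (delta_mx 0 j)); split=> // [y _|a].
  have [v <-] := pis y; exists (v 0); rewrite [pi v]free_mapE subrr.
  exact: mpow_mem0.
have -> : \sum_j a j *: pi (delta_mx 0 j) = pi (\row_j a j).
  by rewrite [RHS]free_mapE; apply: eq_bigr => j _; rewrite mxE.
move=> /(mpow_surj pis)[v mv pv] i.
have /ex[y yE] : pi (\row_j a j - v) = 0 by rewrite linearB pv subrr.
have /mpow_row/(_ i)/mpow1_ring : mpow m 1 _ (\row_j a j).
  by rewrite -(subrK v (\row_j a j)) -yE; apply: mpow_memD.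
by rewrite mxE.
Qed.

(** As m^2 M = 0, [L] contains sF = m^2 F; the socle condition places the preimages of the s e_j in
    mL, and they form a basis. *)
Lemma syzygy_radical p M L : (forall x, mpow m 2 M x -> x = 0) ->
    syzygy_of m p M L -> socle_in_radical m L ->
  exists x : 'I_p -> L, residue_basis m (mpow m 1 L) (mpow m 2 L) x.
Proof.
move=> M2 MLs socL; have L2 := syzygy_square sgR MLs.
have [pi [iota [pis iinj ex im]]] := MLs.
have /choice[y yE] : forall j, exists y, iota y = s *: delta_mx 0 j.
  move=> j; apply/ex/M2/mpow_linear/(row_square sgR).
  by exists (delta_mx 0 j).
have sumE (a : 'I_p -> R) : iota (\sum_j a j *: y j) = s *: \row_j a j.
  rewrite linear_sum [X in s *: X]row_sum_delta scaler_sumr; apply: eq_bigr => j _.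
  by rewrite linearZ /= yE scalerA mulrC -scalerA mxE.
exists y; split=> [j|z mz|a /L2 a0 i].
- apply: socL => a ma; apply: iinj.
  by rewrite linearZ /= yE linear0 scalerA (sg_ann sgR a).2 ?scale0r.
- have /(row_square sgR)[w wE] : mpow m 2 _ (iota z) by exact: (mpow_raise (k := 1) im mz).
  exists (w 0); rewrite (_ : _ - _ = 0); first exact: mpow_mem0.
  apply: iinj; rewrite linearB sumE wE linear0 (_ : \row_j w 0 j = w) ?subrr //.
  by apply/rowP => j; rewrite mxE.
- have := sumE a; rewrite a0 linear0 => /esym/(row_m sgR)/mpow_row/(_ i)/mpow1_ring.
  by rewrite mxE.
Qed.

(** The space mF/m^2 F has two bases: the products x_l e_j, and lifts of a basis of mM together with
    minimal generators of [L]. Independence of the latter needs soc L in mL, since a combination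
    lying in m^2 F is killed by m. *)
Lemma syzygy_count e p q r M L K (x : 'I_e -> R^o) (u : 'I_r -> M) :
    residue_basis m in_m (mpow m 2 R^o) x ->
    (forall x, mpow m 2 M x -> x = 0) ->
    residue_basis m (mpow m 1 M) (mpow m 2 M) u ->
    syzygy_of m p M L -> syzygy_of m q L K -> socle_in_radical m L ->
  (e * p = r + q)%N.
Proof.
move=> [xm xgen xindep] M2 [um ugen uindep] MLs LKs socL.
have [w [_ wgen windep]] := syzygy_top LKs.
have [pi [iota [pis iinj ex im]]] := MLs.
pose A := mpow m 1 'rV[R]_p; pose B := mpow_module m 2 'rV[R]_p.
have basis1 : indexed_basis A (submodule_set B)
    (fun t : 'I_e * 'I_p => x t.1 *: delta_mx 0 t.2 : 'rV[R]_p).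
  have sumE (a : 'I_e * 'I_p -> R) j :
      (\sum_t a t *: (x t.1 *: delta_mx 0 t.2 : 'rV[R]_p)) 0 j =
      \sum_l a (l, j) * x l.
    pose f l j' := (a (l, j') *: (x l *: delta_mx 0 j' : 'rV[R]_p)) 0 j.
    rewrite summxE (eq_bigr (fun t => f t.1 t.2)); last by case.
    rewrite -(pair_bigA _ f) /f /=.
    apply: eq_bigr => l _; rewrite (bigD1 j) //= !mxE !eqxx mulr1.
    rewrite big1 ?addr0 // => j' /negPf jj'.
    by rewrite !mxE eq_sym jj' andbF !mulr0.
  split=> [[l j]|v mv|a /(mpow_row m 2 _).1 Ba [l j]] /=.
  - by apply/mpowS => //; exact: xm.
  - have /choice[c cE] : forall j, exists c : 'I_e -> R,
        mpow m 2 R^o (v 0 j - \sum_l c l *: x l).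
      by move=> j; apply/xgen/mpow1_ring; exact: (mpow_row m 1 v).1.
    exists (fun t => c t.2 t.1); apply: (mpow_row m 2 _).2 => j.
    have subE (w' : 'rV[R]_p) : (v - w') 0 j = v 0 j - w' 0 j by rewrite !mxE.
    by rewrite subE sumE; exact: cE.
  - by have := Ba j; rewrite sumE => /xindep/(_ l).
have /choice[z zE] : forall t, exists z, A z /\ pi z = u t.
  by move=> t; have [z ? ?] := mpow_surj pis (um t); exists z.
have basis2 : indexed_basis A (submodule_set B)
    (fun t : 'I_r + 'I_q => match t with inl t => z t | inr j => iota (w j) end).
  have sumE (a : 'I_r + 'I_q -> R) :
      \sum_t a t *: (match t with inl t => z t | inr j => iota (w j) end) =
      \sum_t a (inl t) *: z t + iota (\sum_j a (inr j) *: w j).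
    rewrite big_sumType /= linear_sum; congr (_ + _).
    by apply: eq_bigr => j _; rewrite linearZ.
  have piE (a : 'I_r + 'I_q -> R) :
      pi (\sum_t a (inl t) *: z t) = \sum_t a (inl t) *: u t.
    by rewrite linear_sum; apply: eq_bigr => t _; rewrite linearZ; have [_ ->] := zE t.
  split=> [[t|j]|v mv|a].
  - by have [] := zE t.
  - exact: im.
  - have [a aE] := ugen _ (mpow_linear pi mv).
    have /ex[l lE] : pi (v - \sum_t a t *: z t) = 0.
      by rewrite linearB (piE (fun t => if t is inl t then a t else 0)) (M2 _ aE).
    have [b bE] := wgen l I.
    exists (fun t => match t with inl t => a t | inr j => b j end).
    rewrite sumE opprD addrA -lE -linearB.
    exact: (mpow_raise (k := 1) im bE).
  rewrite sumE => Ba.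
  have pi0 : pi (\sum_t a (inl t) *: z t) = 0.
    have : pi (\sum_t a (inl t) *: z t + iota (\sum_j a (inr j) *: w j)) = 0.
      by apply: M2; exact: mpow_linear Ba.
    by rewrite linearD [X in _ + X](ex _).2 ?addr0 //; exists (\sum_j a (inr j) *: w j).
  have ma t : in_m (a (inl t)).
    by apply: (uindep (a \o inl)); rewrite -piE pi0; exact: mpow_mem0.
  have mw : mpow m 2 _ (iota (\sum_j a (inr j) *: w j)).
    rewrite -[X in mpow _ _ _ X](addKr (\sum_t a (inl t) *: z t)) addrC.
    apply: mpow_memB => //.
    by apply: mpow_sum => t; apply: mpowS => //; have [] := zE t.
  suff mb j : in_m (a (inr j)) by case.
  apply: (windep (a \o inr)); apply: socL => c mc; apply: iinj; rewrite linear0 linearZ.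
  by move: c mc; apply/(row_socle sgR).
have := krank_unique (indexed_residue_basis basis1).
by rewrite (krank_unique (indexed_residue_basis basis2)) card_sum card_prod !card_ord => ->.
Qed.

End Ranks.

(** * Syzygies of the residue field and their duals *)

Section Residue.
Variables (R : comNzRingType) (m : ideal R) (s : R).
Local Notation in_m := (submodule_set m).
Local Notation k := (residue_field m).
Local Notation dual M := (Defs.hom M R^o).
Hypothesis sgR : short_gorenstein m s.
Let locR := sg_local sgR.
Let m3 := sg_cube sgR.
Implicit Types M N L K U V : lmodType R.

(* [omega F 0] is [M] itself, whereas [syzygy F 0] is only isomorphic to [M]. *)
Definition omega M (F : minimal_free_resolution m M) n : lmodType R :=
  if n is n'.+1 then syzygy F n'.+1 else M.

Lemma omega_syzygy M (F : minimal_free_resolution m M) n :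
  syzygy_of m (betti F n) (omega F n) (omega F n.+1).
Proof. by case: n => [|n]; [exact: resolution_syzygy0|exact: resolution_syzygyS]. Qed.

Lemma omega_chain M (F : minimal_free_resolution m M) n :
  syzygy_chain m n M (omega F n).
Proof. by case: n => [//|n]; exact: resolution_chain. Qed.

Lemma omega_square M (F : minimal_free_resolution m M) n :
    (forall x, mpow m 2 M x -> x = 0) ->
  forall x, mpow m 2 (omega F n) x -> x = 0.
Proof.
by case: n => [//|n] _; exact: (syzygy_square sgR (omega_syzygy F n)).
Qed.

Section ResidueResolution.
Variable G : minimal_free_resolution m k.

Lemma dual_omega_syzygy n :
  syzygy_of m (betti G n) (dual (omega G n.+1)) (dual (omega G n)).
Proof.
apply: (dual_syzygy sgR) (omega_syzygy G n); apply: omega_square.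
exact: residue_field_square.
Qed.

Lemma dual_omega_square n x : mpow m 2 (dual (omega G n)) x -> x = 0.
Proof. by move: x; exact: (syzygy_square sgR (dual_omega_syzygy n)). Qed.

Lemma dual_omega_chain n : syzygy_chain m n (dual (omega G n)) (dual k).
Proof.
exact: (dual_syzygy_chain sgR (@residue_field_square R m) (omega_chain G n)).
Qed.

(** The n-th syzygy of the dual of Omega_n(k) is Hom(k,R), that is k, so retracts can be moved n
    steps down or up the two chains. *)
Lemma socle_dual_retract M (F : minimal_free_resolution m M) n :
  ~ socle_in_radical m (omega F n) <-> retract (dual (omega G n)) M.
Proof.
have [kd dk] := residue_field_dual sgR.
rewrite (socle_in_radicalPn sgR (omega_syzygy F n)); split=> [kF|NM].
  apply: (syzygy_chain_coretract sgR _ (dual_omega_chain n) (omega_chain F n)).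
    exact: dual_omega_square.
  exact: retract_trans dk kF.
apply: retract_trans kd _.
exact: (syzygy_chain_retract sgR (dual_omega_chain n) (omega_chain F n) NM).
Qed.

End ResidueResolution.

Lemma retract_residue_cyclic p M L :
  syzygy_of m p M L -> retract M k -> (p <= 1)%N.
Proof.
move=> /syzygy_top[x xb] [f [g gf]].
have [q [qsurj _ q1]] := residue_field_map m.
apply: (residue_basis_cyclic locR xb (g := g (q 1))) => [a ma|y _].
  exact: mpowS.
by have [c cE] := qsurj (f y); exists c; rewrite -linearZ -q1 cE gf.
Qed.

(* L = mF for the free cover F of M, so that soc L = m^2 F = mL. *)
Lemma radical_zero_socle p M L : (forall x, mpow m 1 M x -> x = 0) ->
  syzygy_of m p M L -> socle_in_radical m L.
Proof.
move=> M1 [pi [iota [pis iinj ex im]]] y my.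
have my2 : mpow m 2 _ (iota y).
  by apply/(row_socle sgR) => a ma; rewrite -linearZ /= my // linear0.
have : exists2 z, mpow m 1 L z & iota z = iota y.
  move: (iota y) my2; apply: mpow_ind => [|_ _ [u mu <-] [v mv <-]|a v ma mv].
  - by exists 0; rewrite ?linear0 //; exact: mpow_mem0.
  - by exists (u + v); rewrite ?linearD //; exact: mpow_memD.
  - have /ex[z <-] : pi v = 0 by apply: M1; exact: mpow_linear.
    by exists (a *: z); rewrite ?linearZ //; exact: mpowS.
by move=> [z mz /iinj <-].
Qed.

Lemma residue_field_basis : exists x : 'I_1 -> k,
  residue_basis m (mpow m 0 k) (mpow m 1 k) x.
Proof.
have [q [qsurj qker q1]] := residue_field_map m.
exists (fun=> q 1); split=> // [y _|a].
  have [c cE] := qsurj y; exists (fun=> c).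
  by rewrite big_ord1 -q1 cE subrr; exact: mpow_mem0.
by rewrite big_ord1 -q1 => /residue_field_radical/qker a0 i; rewrite ord1.
Qed.

Lemma zero_basis M (A B : set M) : (forall y, A y -> y = 0) -> B 0 ->
  exists x : 'I_0 -> M, residue_basis m A B x.
Proof.
move=> A0 B0; exists (fun=> 0); split=> [[]//|y /A0 ->|a _ []//].
by exists (fun=> 0); rewrite big_ord0 subrr.
Qed.

Lemma residue_finite : finite_module k.
Proof.
have [q [qsurj _ q1]] := residue_field_map m.
exists 1%N, (fun=> q 1); apply/seteqP; split=> // y _.
have [c cE] := qsurj y; exists (fun=> c) => //.
by rewrite big_ord1 -q1.
Qed.

Lemma hilbert_basis n M d (x : 'I_d -> M) :
  residue_basis m (mpow m n M) (mpow m n.+1 M) x -> hilbert m M n = d.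
Proof. exact: (krank_unique sgR (B := mpow_module m n.+1 M)). Qed.

Lemma hilbert_isomorphic n d U V (x : 'I_d -> U) : isomorphic U V ->
  residue_basis m (mpow m n U) (mpow m n.+1 U) x -> hilbert m V n = d.
Proof.
move=> [f /bij_linear_inv[g [fK gK]]] [xm xgen xindep].
have sumE (a : 'I_d -> R) : \sum_i a i *: f (x i) = f (\sum_i a i *: x i).
  by rewrite linear_sum; apply: eq_bigr => i _; rewrite linearZ.
apply: (hilbert_basis (x := f \o x)); split=> [i|y my|a] /=.
- exact/mpow_linear/xm.
- have [a aE] := xgen _ (mpow_linear g my); exists a.
  by rewrite sumE -[y]gK -linearB; exact: (mpow_linear (n := n.+1) f).
- by rewrite sumE => mf; have := mpow_linear (n := n.+1) g mf; rewrite fK => /xindep.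
Qed.

Section Count.
Variables (e : nat) (x : 'I_e -> R^o).
Hypothesis xb : residue_basis m in_m (mpow m 2 R^o) x.

Lemma betti_count0 M (F : minimal_free_resolution m M) r (u : 'I_r -> M) :
    (forall y, mpow m 2 M y -> y = 0) ->
    residue_basis m (mpow m 1 M) (mpow m 2 M) u ->
    socle_in_radical m (omega F 1) ->
  (e * betti F 0 = r + betti F 1)%N.
Proof.
move=> M2 ub soc.
exact: (syzygy_count sgR xb M2 ub (omega_syzygy F 0) (omega_syzygy F 1) soc).
Qed.

Lemma betti_countS M (F : minimal_free_resolution m M) n :
    (forall y, mpow m 2 M y -> y = 0) ->
    socle_in_radical m (omega F n.+1) -> socle_in_radical m (omega F n.+2) ->
  (e * betti F n.+1 = betti F n + betti F n.+2)%N.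
Proof.
move=> M2 soc1 soc2; have M'2 j := @omega_square M F j M2.
have [u ub] := syzygy_radical sgR (M'2 n) (omega_syzygy F n) soc1.
exact: (syzygy_count sgR xb (M'2 n.+1) ub (omega_syzygy F n.+1) (omega_syzygy F n.+2) soc2).
Qed.

Variables (b : nat -> int).
Hypotheses (e_ge2 : (2 <= e)%N) (b0 : b 0%N = 1) (b1 : b 1%N = e%:Z).
Hypothesis bS : forall n : nat, (1 <= n)%N -> b n.+1 = e%:Z * b n - b n.-1.

(** As e >= 2, the increments satisfy b_(n+1) - b_n >= b_n - b_(n-1). *)
Lemma b_growth n : (0 < b n)%R /\ (b n < b n.+1)%R.
Proof.
elim: n => [|n [bn bn1]]; first by rewrite b0 b1; lia.
by rewrite (bS (n := n.+1)) //=; nia.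
Qed.

Lemma b_gt1 n : (1 < b n.+1)%R.
Proof. by have [] := b_growth n; lia. Qed.

Lemma betti_residue (G : minimal_free_resolution m k) n :
  [/\ (betti G n)%:Z = b n, (betti G n.+1)%:Z = b n.+1 &
      forall j, (0 < j <= n.+1)%N -> socle_in_radical m (omega G j)].
Proof.
elim: n => [|n [IHn IHn1 soc]].
  have [u /hilbert_basis h1] := residue_field_basis.
  have [v /hilbert_basis h2] := syzygy_top (omega_syzygy G 0).
  have betti0 : betti G 0 = 1%N by rewrite -h1 -h2.
  have soc1 := radical_zero_socle (@residue_field_radical R m) (omega_syzygy G 0).
  have [w wb] := zero_basis (@residue_field_radical R m) (mpow_mem0 m 2 k).
  have := betti_count0 (@residue_field_square R m) wb soc1.
  rewrite betti0 b0 b1 => count; split=> //; first by lia.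
  by case=> [//|[|j]] // _; exact: soc1.
(* Otherwise the dual of Omega_(n+2)(k) would be a retract of k, hence cyclic, whereas its minimal
   cover has rank b_(n+1) > 1. *)
have soc' : socle_in_radical m (omega G n.+2).
  apply: contrapT => /(socle_dual_retract G).
  by move=> /(retract_residue_cyclic (dual_omega_syzygy G n.+1)); have := b_gt1 n; lia.
have := betti_countS (@residue_field_square R m) (soc n.+1 _) soc'.
rewrite ltnSn => /(_ isT) count; split=> //.
  by rewrite (bS (n := n.+1)) //=; lia.
move=> j /andP[j0]; rewrite leq_eqVlt => /orP[/eqP -> //|jn].
by apply: soc; rewrite j0.
Qed.

Lemma hilbert_dual_omega (G : minimal_free_resolution m k) i M n :
    isomorphic M (dual (syzygy G i.+1)) ->
  (hilbert m M n)%:Z = ((b i)%:P + b i.+1 *: 'X)`_n.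
Proof.
move=> /isomorphic_sym iso; have [bi bi1 _] := betti_residue G i.
rewrite coefD coefC coefZ coefX.
case: n => [|[|n]] /=.
- have [x' /(hilbert_isomorphic iso) ->] := syzygy_top (dual_omega_syzygy G i).
  by rewrite bi mulr0 addr0.
(* Otherwise k is a retract of this dual; passing to (i+1)-th syzygies, Omega_(i+1)(k) would be a
   retract of k, although its minimal cover has rank b_(i+1) > 1. *)
- have soc : socle_in_radical m (dual (omega G i.+1)).
    apply: contrapT => /(socle_in_radicalPn sgR (dual_omega_syzygy G i)).
    move=> kN; have [_ dk] := residue_field_dual sgR.
    have := syzygy_chain_retract sgR (omega_chain G i.+1) (dual_omega_chain G i.+1) kN.
    move=> /retract_trans/(_ dk)/(retract_residue_cyclic (omega_syzygy G i.+1)).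
    by have := b_gt1 i; lia.
  have [x' /(hilbert_isomorphic iso) ->] :=
    syzygy_radical sgR (@dual_omega_square G i.+2) (dual_omega_syzygy G i.+1) soc.
  by rewrite bi1 mulr1 add0r.
- have [y my|x' /(hilbert_isomorphic iso) ->] :=
      @zero_basis (dual (syzygy G i.+1)) (mpow m n.+2 _) _ _ (mpow_mem0 m n.+3 _).
    by apply: (@dual_omega_square G i.+1); exact: mpow_le my.
  by rewrite mulr0 addr0.
Qed.

Lemma dual_omega_nonzero (G : minimal_free_resolution m k) i M :
  isomorphic M (dual (syzygy G i.+1)) -> ~ zero_module M.
Proof.
move=> iso M0; have := hilbert_dual_omega 0 iso.
have [x' /hilbert_basis ->] :=
  zero_basis (A := mpow m 0 M) (fun y _ => M0 y) (mpow_mem0 m 1 M).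
rewrite coefD coefC coefZ coefX /= mulr0 addr0.
by have [] := b_growth i; lia.
Qed.

Lemma koszul_hilbert M (F : minimal_free_resolution m M) i :
    finite_module M -> (forall n, socle_in_radical m (omega F n.+1)) ->
  ~ forall n, (hilbert m M n)%:Z = ((b i)%:P + b i.+1 *: 'X)`_n.
Proof.
move=> Mfin soc HM.
have coefE n : ((b i)%:P + b i.+1 *: 'X)`_n =
    (if n == 0 then b i else if n == 1 then b i.+1 else 0)%N.
  rewrite coefD coefC coefZ coefX.
  by case: n => [|[|n]]; rewrite /= ?mulr0 ?mulr1 ?addr0 ?add0r.
(* The zero coefficient in degree 2 means m^2 M = m^3 M, which is 0. *)
have M2 y : mpow m 2 M y -> y = 0.
  have [d [x' xb']] := mpow_basis locR m3 2 Mfin.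
  have := HM 2%N; rewrite coefE (hilbert_basis xb') /= => d0.
  have {}d0 : d = 0%N by lia.
  case: d x' xb' d0 => // x' [_ xgen _] _ /xgen[a].
  rewrite big_ord0 subr0; exact: (mpow_ge3_eq0 m3).
have [r [u ub]] := mpow_basis locR m3 1 Mfin.
have := HM 1%N; rewrite coefE (hilbert_basis ub) /= => rE.
have [v vb] := syzygy_top (omega_syzygy F 0).
have := HM 0%N; rewrite coefE (hilbert_basis vb) /= => pE.
have count0 := betti_count0 M2 ub (soc 0%N).
have countS n := betti_countS M2 (soc n) (soc n.+1).
(* The Betti numbers of [M] run through the sequence [b] backwards, and hence
   become negative. *)
have bettiE j : (j <= i)%N -> (betti F j)%:Z = b (i - j)%N /\
    (if j is j'.+1 then betti F j' else r)%:Z = b (i - j).+1.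
  elim: j => [|j IH] ji; first by rewrite subn0.
  have [IH1 IH2] := IH (ltnW ji).
  have bSj := bS (n := (i - j)%N); rewrite subn_gt0 ji in bSj.
  rewrite [(i - j.+1)%N]subnS prednK ?subn_gt0 //; split=> //.
  have := bSj isT; case: (j) IH1 IH2 => [|j'] IH1 IH2.
    by have := count0; lia.
  by have := countS j'; lia.
(* At j = i the last two terms are 1 and e, so the next Betti number is 0 and the one after it would
   be -1. *)
have [] := bettiE i (leqnn i); rewrite subnn b0 b1.
have := countS i; case: (i) => [|i'] counti bi bi'.
  by have := count0; nia.
by have := countS i'; nia.
Qed.

End Count.
End Residue.

(** * The Koszul criterion and the three equivalent conditions *)

Lemma isomorphic_prod_zero (R : comNzRingType) (U V : lmodType R) :
  zero_module V -> isomorphic (U * V)%type U.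
Proof.
move=> V0; have [a x y|f fE] := @linear_build R (U * V)%type U fst; first by [].
exists f, (fun u => (u, 0)) => [[u v]|u]; rewrite fE //=.
by rewrite (V0 v).
Qed.

(** [socle_dual_retract] holds for every resolution of [M] and of k, so the existential choices in
    [koszul] and [iso_neg_syzygy] need not match. *)
Lemma koszul_iff_no_dual_omega (R : comNzRingType) (m : ideal R) (s : R)
    (M : lmodType R) :
    short_gorenstein m s -> finite_module M ->
  koszul m M <->
  ~ exists (i : nat) (N : lmodType R),
      [/\ (1 <= i)%N, iso_neg_syzygy m i N & direct_summand N M].
Proof.
move=> sgR Mfin; have locR := sg_local sgR; have m3 := sg_cube sgR.
split=> [[F /(koszulP sgR) soc] [[|n] [N [// _ [G NG] /direct_summandP NM]]]|noN].
  have [_ GN] := isomorphic_retract NG.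
  by have /(socle_dual_retract sgR G F n.+1) := retract_trans GN NM; apply; exact: soc.
have [F] := minimal_resolution_exists locR m3 Mfin.
have [G] := minimal_resolution_exists locR m3 (residue_finite m).
exists F; apply/(koszulP sgR) => n; apply: contrapT.
move=> /(socle_dual_retract sgR G F n.+1) NM; apply: noN.
exists n.+1, (Defs.hom (syzygy G n.+1) R^o); split=> //; last exact/direct_summandP.
by exists G, idfun, idfun.
Qed.

Theorem theorem4p6 (R : comNzRingType) (m : ideal R) (e : nat) (b : nat -> int)
  (gorR : gorenstein_local_ring m)
  (m3 : mpow m 3 R^o = [set 0])
  (eE : e = krank m (m : set R^o) (mpow m 2 R^o))
  (e_ge2 : (2 <= e)%N)
  (b0 : b 0%N = 1)
  (b1 : b 1%N = e%:Z)
  (bS : forall n : nat, (1 <= n)%N -> b n.+1 = e%:Z * b n - b n.-1) :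
  (forall M : lmodType R, finite_module M ->
     (koszul m M <->
      ~ exists (i : nat) (N : lmodType R),
          [/\ (1 <= i)%N, iso_neg_syzygy m i N & direct_summand N M]))
  /\
  (forall M : lmodType R, finite_module M -> indecomposable M ->
     [<-> ~ koszul m M;
          exists2 i : nat, (1 <= i)%N & iso_neg_syzygy m i M;
          exists2 i : nat, (1 <= i)%N &
            forall n : nat,
              (hilbert m M n)%:Z = ((b i.-1)%:P + b i *: 'X)`_n]).
Proof.
have [|s sgR] := gorenstein_short gorR m3; first by rewrite -eE.
have [x xb] : exists x : 'I_e -> R^o, residue_basis m (submodule_set m) (mpow m 2 R^o) x.
  (* The default value 0 of [krank] is excluded by e >= 2, so a basis exists. *)
  move: eE e_ge2; rewrite /krank; case: xgetP => [d _ dP ->|_ ->] //.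
have koszulE := koszul_iff_no_dual_omega sgR.
split=> [M Mfin|M Mfin [_ Mind]]; first exact: koszulE.
tfae.
- rewrite (koszulE M Mfin) => /contrapT[[|i] [N [// _ [G NG] [N' MNN']]]].
  (* The summand [N] is nonzero because its Hilbert series has constant term b_i > 0, so the
     complement vanishes. *)
  have [N0|N'0] := Mind _ _ MNN'.
    by case: (dual_omega_nonzero sgR xb e_ge2 b0 b1 bS NG N0).
  exists i.+1 => //; exists G; apply: isomorphic_trans NG.
  exact: isomorphic_trans MNN' (isomorphic_prod_zero N N'0).
- move=> [[|i] // _ [G iso]]; exists i.+1 => // n.
  exact: (hilbert_dual_omega sgR xb e_ge2 b0 b1 bS n iso).
- move=> [[|i] // _ HM] [F /(koszulP sgR) soc].
  exact: (koszul_hilbert sgR xb e_ge2 b0 b1 bS (F := F) Mfin soc HM).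
Qed.
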